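(* Let $q$ be a complex number with $0<|q|<1$, let $\alpha\ge 0$ be real, let $r\ge 2$ be an integer, and let $\zeta_r=e^{2\pi i/r}$. Let $a,b,x\in\mathbb{C}$ with $a\neq0$, $x\ne 0$, $|b/a|<1$, $a^r\ne q^{rj}$ for every integer $j\ge1$, and $b^r\neq q^{-rj}$ for every integer $j\ge 0$; in the case $\alpha=0$ assume moreover $|b/a|<|x|<1$. Then $$B_{q^{r}}^{(r\alpha)}(a^{r},b^{r};x^{r})=\frac{(b,q/a;q)_{\infty}^{r}}{(q,b/a;q)_{\infty}^{r}}\,\frac{(q^{r},b^{r}a^{-r};q^{r})_\infty}{(b^{r},q^{r}a^{-r};q^{r})_{\infty}}\sum_{k_1,\dots,k_{r-1}=-\infty}^{\infty}\frac{(a;q)_{k_1}\cdots(a;q)_{k_{r-1}}\,\zeta_r^{\sum_{i=1}^{r-1}ik_i}\,q^{\alpha\left(\sum_{i=1}^{r-1} k_i\right)^{2}}\,x^{\sum_{i=1}^{r-1}k_i}}{(b;q)_{k_1}\cdots(b;q)_{k_{r-1}}}\;B_{q}^{(\alpha)}\!\left(a,b;\,x\,q^{2\alpha\sum_{i=1}^{r-1}k_i}\right).$$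
   Context: For $0<|p|<1$: $(x;p)_\infty=\prod_{j\ge 0}(1-xp^j)$; for an integer $n\ge 0$, $(x;p)_n=\prod_{j=0}^{n-1}(1-xp^j)$, and $(x;p)_{-n}=1/(xp^{-n};p)_n$, so that $1/(x;p)_{-n}=(xp^{-n};p)_n$. Also $(x_1,\dots,x_s;p)_\infty=\prod_i(x_i;p)_\infty$, and $(x_1,\dots,x_s;p)_\infty^r$ is its $r$-th power. For $\alpha\ge 0$ define $$B_{q}^{(\alpha)}(a,b;x)=\sum_{n=-\infty}^{\infty}\frac{(a;q)_{n}}{(b;q)_{n}}\,q^{\alpha n^{2}}x^{n}.$$ Real powers are taken with a fixed choice of $\log q$: $q^y=e^{y\log q}$ and $(q^r)^y=q^{ry}$. *)

(* Defs.v *)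
From HB Require Import structures.
From mathcomp Require Import all_boot all_order all_algebra.
From mathcomp Require Import all_classical all_reals all_analysis.
From mathcomp Require Import summability.
From mathcomp Require Export complex.

Set Implicit Arguments.
Unset Strict Implicit.
Unset Printing Implicit Defensive.

Import Order.TTheory GRing.Theory Num.Theory.
Import numFieldNormedType.Exports.

Local Open Scope classical_set_scope.
Local Open Scope ring_scope.

Section QPochhammer.
Variable K : numFieldType.
Implicit Types (p x : K) (n : nat).

(* (x;p)_n for n >= 0 *)
Definition qpochn p x n : K := \prod_(j < n) (1 - x * p ^+ j).

(* (x;p)_n for n an integer; Negz n stands for -(n+1).  When
   (x p^(-n);p)_n = 0 the convention 0^-1 = 0 gives (x;p)_(-n) = 0, hence
   1 / (x;p)_(-n) = (x p^(-n);p)_n holds without exception. *)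
Definition qpoch p x (n : int) : K :=
  match n with
  | Posz m => qpochn p x m
  | Negz m => (qpochn p (x * p ^- m.+1) m.+1)^-1
  end.

(* (x;p)_oo *)
Definition qpochoo p x : K := limn (qpochn p x : nat -> K).

(* (x_1, ..., x_s;p)_oo *)
Definition qpochsoo p (s : seq K) : K := \prod_(x <- s) qpochoo p x.

End QPochhammer.

(* Unordered summation over an arbitrary index type: convergence, and limit, of
   the net of the finite partial sums.  For complex-valued families this is
   absolute convergence. *)
Definition usummable (I : choiceType) (K : numFieldType) (f : I -> K) : Prop :=
  cvg (partial_sum f @ totally).

Definition usum (I : choiceType) (K : numFieldType) (f : I -> K) : K :=
  summability.sum f.

Section Bilateral.
Variable R : realType.
Local Notation C := (complex R).
Implicit Types (q lq a b x : C) (alpha y : R).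

Definition cexp (z : C) : C :=
  (expR (complex.Re z))%:C%C *
  Complex (cos (complex.Im z)) (sin (complex.Im z)).

(* q ^ y for real y, where lq is the chosen logarithm of q *)
Definition qpow lq y : C := cexp (y%:C%C * lq).

(* e^(2 pi i / r) *)
Definition zeta (r : nat) : C := cexp (Complex 0 (2 * pi / r%:R)).

(* The base q enters both through integer powers and, via its logarithm lq,
   through the real power q^(alpha n^2). *)
Definition Bterm q lq alpha a b x (n : int) : C :=
  qpoch q a n / qpoch q b n * qpow lq (alpha * n%:~R ^+ 2) * x ^ n.

Definition Bseries q lq alpha a b x : C := usum (Bterm q lq alpha a b x).

(* The family indexed by (k_1, ..., k_(r-1)); k_i is k (i - 1) with
   i - 1 : 'I_(r.-1). *)
Definition multiterm (r : nat) q lq alpha a b x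
    (k : {ffun 'I_r.-1 -> int}) : C :=
  let s := \sum_i k i in
  (\prod_i qpoch q a (k i)) * zeta r ^ (\sum_(i < r.-1) i.+1%:Z * k i)
    * qpow lq (alpha * s%:~R ^+ 2) * x ^ s
    / (\prod_i qpoch q b (k i))
  * Bseries q lq alpha a b (x * qpow lq (2 * alpha * s%:~R)).

End Bilateral.

(* Main.v *)
(** For [|b / a| < |z| < 1] put [F(z) = sum_n (a;q)_n / (b;q)_n z^n].  Ramanujan's
    1psi1 formula writes [F] as a quotient of infinite products, and
    [prod_(i < r) (x w^i; q)_oo = (x^r; q^r)_oo] for [w = zeta_r], so that
    [prod_(i < r) F(w^i z)] is a constant times the same series for
    [(a^r, b^r; q^r)] at [z^r].  Comparing Laurent coefficients evaluates, for
    each [N], the convolution sum over [k_1 + ... + k_r = N]; weighting it by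
    [q^(alpha N^2) x^N] and summing over [N] gives the theorem.  All the sums
    converge absolutely because [|q^(alpha N^2) x^N| <= M t^N] for some
    [t] in [(|b / a|, 1)].

    The 1psi1 formula is obtained from the contiguous relation between [b] and
    [b q] iterated to [b = 0], where the value is identified through the case
    [b = q], which is the q-binomial theorem. *)
Require Import Defs.
From HB Require Import structures.
From mathcomp Require Import all_boot all_order all_algebra.
From mathcomp Require Import all_classical all_reals all_analysis.
From mathcomp Require Import finmap summability.
From mathcomp Require Import ring lra.

Set Implicit Arguments.
Unset Strict Implicit.
Unset Printing Implicit Defensive.

Import Order.TTheory GRing.Theory Num.Theory.
Import numFieldNormedType.Exports.
Local Open Scope ring_scope.

(** For [alpha > 0] the point [x] is any nonzero number, and neither [F(x)] nor the unweighted inner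
    series need converge there. Hence [x] enters only through the weight: the coefficients are
    compared on a circle [|z| = t] inside the annulus, which gives identities between numbers free
    of [x], and these are weighted afterwards. The right-hand side is one absolutely summable family
    over [(k_1, ..., k_r)]. Grouped by [(k_1, ..., k_(r-1))] it yields the multiple sum, because
    [(s + m)^2 = s^2 + 2 s m + m^2]; grouped by the total it yields the left-hand side.

    In the 1psi1 formula, the value at [b = q] is available only when [|q / a| < |z|], which
    [|b / a| < |z| < 1] does not give. At [b = 0] the annulus is [0 < |z| < 1], and there [a] can be
    replaced by [a / q] until the inequality holds. This, with dominated convergence along
    [b q^n -> 0], takes the place of analytic continuation in [b]. *)

Section Summation.
Variable R : realType.
Local Notation C := (complex R).
Local Notation K := (Num.NumField.sort (C : numFieldType)).
Local Open Scope fset_scope.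
Local Open Scope classical_set_scope.
Local Open Scope ring_scope.

(** * The modulus as a real number *)

Definition nm (z : C) : R := ComplexField.Normc.normc z.

Arguments nm : simpl never.

(** The norm of [C] takes values in [C], which is only partially ordered; estimates are carried out
    on the real number [nm z], where suprema and linear arithmetic apply. *)
Lemma normE (z : C) : `|z| = (nm z)%:C%C.
Proof. by []. Qed.

Lemma nm_ge0 z : 0 <= nm z.
Proof. by case: z => u v; apply: sqrtr_ge0. Qed.

Lemma nmM z w : nm (z * w) = nm z * nm w.
Proof. exact: ComplexField.Normc.normcM. Qed.

Lemma nmV z : nm z^-1 = (nm z)^-1.
Proof. exact: ComplexField.Normc.normcV. Qed.

Lemma nm0 : nm 0 = 0.
Proof. exact: ComplexField.Normc.normc0. Qed.

Lemma nm1 : nm 1 = 1.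
Proof. exact: ComplexField.Normc.normc1. Qed.

Lemma nm_eq0 z : (nm z == 0) = (z == 0).
Proof.
apply/eqP/eqP => [|->]; last exact: nm0.
exact: ComplexField.Normc.eq0_normc.
Qed.

Lemma nm_gt0 z : (0 < nm z) = (z != 0).
Proof. by rewrite lt_def nm_eq0 nm_ge0 andbT. Qed.

Lemma nmN z : nm (- z) = nm z.
Proof. by case: z => u v; rewrite /nm /= !sqrrN. Qed.

Lemma ler_nmD z w : nm (z + w) <= nm z + nm w.
Proof. exact: le_normcD. Qed.

Lemma ler_nmB z w : nm (z - w) <= nm z + nm w.
Proof. by rewrite -(nmN w) ler_nmD. Qed.

Lemma nmX z n : nm (z ^+ n) = nm z ^+ n.
Proof. by elim: n => [|n IH]; rewrite ?expr0 ?nm1 // !exprS nmM IH. Qed.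

Lemma nmXz z (n : int) : nm (z ^ n) = nm z ^ n.
Proof. by case: n => n; rewrite ?NegzE -?exprnN /= -?exprnP ?nmV ?nmX. Qed.

Lemma nm_real (t : R) : nm t%:C%C = `|t|.
Proof. by rewrite /nm /= expr0n addr0 sqrtr_sqr. Qed.

Lemma nm_prod I (r : seq I) (F : I -> C) :
  nm (\prod_(i <- r) F i) = \prod_(i <- r) nm (F i).
Proof.
by elim: r => [|i r IH]; rewrite ?big_nil ?nm1 // !big_cons nmM IH.
Qed.

Lemma ler_nm_sum I (r : seq I) (P : pred I) (F : I -> C) :
  nm (\sum_(i <- r | P i) F i) <= \sum_(i <- r | P i) nm (F i).
Proof.
elim: r => [|i r IH]; rewrite ?big_nil ?nm0 // !big_cons.
by case: (P i) => //; apply: le_trans (ler_nmD _ _) _; rewrite lerD2l.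
Qed.

Lemma cvg_nmP T (F : set_system T) {FF : Filter F} (f : T -> K) (l : K) :
  f @ F --> l <-> forall e : R, 0 < e -> \forall x \near F, nm (l - f x) < e.
Proof.
split=> [/cvgrPdist_lt fl e e0|fl].
  have /fl : 0 < e%:C%C :> C by rewrite ltcR.
  by apply: filterS => x; rewrite normE ltcR.
(* A positive element of [C] has zero imaginary part, so real tolerances suffice. *)
apply/cvgrPdist_lt => -[e e'] /[dup] /= /andP[/eqP -> _].
rewrite ltcR => /fl; apply: filterS => x; rewrite normE.
by rewrite -complexr0 ltcR.
Qed.

(** * Unordered sums of complex families *)

Definition has_sum (I : choiceType) (f : I -> C) (s : C) : Prop :=
  partial_sum f @ totally --> (s : K).

#[local] Existing Instance totally_filter.

Lemma partial_sumE (I : choiceType) (V : zmodType) (f : I -> V) (A : {fset I}) :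
  partial_sum f A = \sum_(i <- A) f i.
Proof. by rewrite big_seq_fsetE. Qed.

Lemma has_sumP (I : choiceType) (f : I -> C) (s : C) :
  has_sum f s <->
  forall e : R, 0 < e -> exists A : {fset I}, forall B : {fset I},
    (A `<=` B)%fset -> nm (s - \sum_(i <- B) f i) < e.
Proof.
have P := @cvg_nmP _ totally (@totally_filter I) (partial_sum f) s.
split=> [/P h e /h [A _ hA]|h].
  by exists A => B AB; rewrite -partial_sumE; apply: hA.
apply/P => e /h [A hA]; exists A => // B /= AB.
by rewrite partial_sumE; apply: hA.
Qed.

Section Generic.
Variable I : choiceType.
Implicit Types (f g : I -> C) (s t : C).

Lemma has_sum_usummable f s : has_sum f s -> usummable f.
Proof. by move=> h; apply/cvg_ex; exists s. Qed.

Lemma has_sum_usum f s : has_sum f s -> usum f = s.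
Proof. exact: (@cvg_lim K (@norm_hausdorff _ _) _ totally totally_filter). Qed.

Lemma has_sum_unique f s t : has_sum f s -> has_sum f t -> s = t.
Proof. by move=> /has_sum_usum <- /has_sum_usum. Qed.

Lemma eq_has_sum f g s : f =1 g -> has_sum f s -> has_sum g s.
Proof. by move=> /funext ->. Qed.

Lemma has_sumD f g s t :
  has_sum f s -> has_sum g t -> has_sum (fun i => f i + g i) (s + t).
Proof.
move=> hf hg; rewrite /has_sum.
rewrite (_ : partial_sum _ =
  (fun A => partial_sum f A + partial_sum g A)); last first.
  by apply/funext => A; rewrite /partial_sum /= big_split.
exact: (@cvgD _ K _ _ _ _ _ _ _ hf hg).
Qed.

Lemma has_sumZ c f s : has_sum f s -> has_sum (fun i => c * f i) (c * s).
Proof.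
move=> hf; rewrite /has_sum.
rewrite (_ : partial_sum _ = fun A => c * partial_sum f A); last first.
  by apply/funext => A; rewrite /partial_sum /= big_distrr.
exact: (@cvgM K _ totally _ (fun=> c) (partial_sum f) c s (cvg_cst (c : K)) hf).
Qed.

Arguments has_sumZ c {f s}.

Lemma has_sumB f g s t :
  has_sum f s -> has_sum g t -> has_sum (fun i => f i - g i) (s - t).
Proof.
move=> hf /(has_sumZ (-1)); rewrite mulN1r => /(has_sumD hf).
by apply: eq_has_sum => i; rewrite mulN1r.
Qed.

Lemma has_sum_sum J (r : seq J) (F : J -> I -> C) (S : J -> C) :
  (forall j, has_sum (F j) (S j)) ->
  has_sum (fun i => \sum_(j <- r) F j i) (\sum_(j <- r) S j).
Proof.
move=> h; elim: r => [|j r IH].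
  rewrite big_nil; apply/has_sumP => e e0; exists fset0 => B _.
  by rewrite big1 ?subr0 ?nm0 // => i _; rewrite big_nil.
rewrite big_cons; apply: eq_has_sum (has_sumD (h j) IH) => i.
by rewrite big_cons.
Qed.

End Generic.
Arguments has_sumZ {I} c {f s}.

(** * Absolute summability: reindexing, Fubini, products, ratio test, dominated convergence *)

Section Absolute.
Implicit Types (I J : choiceType).

(** For nonnegative families this is summability, in a form that passes directly through comparison
    and injective reindexing. *)
Definition bsum I (g : I -> R) : Prop :=
  exists M, forall A : {fset I}, \sum_(i <- A) g i <= M.

Definition asum I (f : I -> C) : Prop := bsum (fun i => nm (f i)).

Lemma ler_sum_fsub I (g : I -> R) (A B : {fset I}) :
  (forall i, 0 <= g i) -> (A `<=` B)%fset ->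
  \sum_(i <- A) g i <= \sum_(i <- B) g i.
Proof.
move=> g0 /fsubsetP AB; rewrite (big_fsetID _ (mem A) B) /=.
rewrite (_ : [fset x in B | x \in A]%fset = A); last first.
  apply/fsetP => i; rewrite !inE /=.
  by apply/andP/idP => [[]|iA] //; split => //; apply: AB.
by rewrite lerDl sumr_ge0.
Qed.

Lemma sum_fsetU I (V : zmodType) (g : I -> V) (A B : {fset I}) :
  \sum_(i <- (A `|` B)%fset) g i =
  \sum_(i <- A) g i + \sum_(i <- (B `\` A)%fset) g i.
Proof.
rewrite (big_fsetID _ (mem A)) /=; congr (_ + _); apply: eq_fbigl => i.
  by rewrite !inE /=; case: (i \in A); case: (i \in B).
by rewrite !inE /=; case: (i \in A); case: (i \in B).
Qed.

Lemma has_sum_sup I (g : I -> R) :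
  (forall i, 0 <= g i) -> bsum g ->
  has_sum (fun i => (g i)%:C%C) (sup (range (fun A : {fset I} =>
     \sum_(i <- A) g i)))%:C%C.
Proof.
move=> g0 [M hM]; set S := (X in sup X).
have hS : has_sup S.
  split; first by exists (\sum_(i <- (fset0 : {fset I})) g i), fset0.
  by exists M => _ [A _ <-].
apply/has_sumP => e e0.
have [_ [A _ <-] hA] := sup_adherent e0 hS.
exists A => B AB; rewrite -rmorph_sum -rmorphB /= nm_real.
have hB : \sum_(i <- B) g i <= sup S.
  by apply: ub_le_sup; [case: hS | exists B].
have := ler_sum_fsub g0 AB.
by rewrite ger0_norm; lra.
Qed.

Lemma bsum_le I (g h : I -> R) c :
  0 <= c -> (forall i, g i <= c * h i) -> bsum h -> bsum g.
Proof.
move=> c0 gh [M hM]; exists (c * M) => A.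
apply: (@le_trans _ _ (\sum_(i <- A) c * h i)); first exact: ler_sum.
by rewrite -big_distrr /= ler_wpM2l.
Qed.

Lemma asum_le I (f g : I -> C) (c : R) :
  0 <= c -> (forall i, nm (f i) <= c * nm (g i)) -> asum g -> asum f.
Proof. exact: bsum_le. Qed.

Lemma bsum_inj I J (h : J -> I) (g : I -> R) :
  injective h -> bsum g -> bsum (g \o h).
Proof.
move=> hI [M hM]; exists M => A.
suff <- : \sum_(j <- (h @` A)%fset) g j = \sum_(i <- A) g (h i) by exact: hM.
by rewrite big_imfset //= => x y _ _ /hI.
Qed.

Lemma asum_inj I J (h : J -> I) (f : I -> C) :
  injective h -> asum f -> asum (f \o h).
Proof. exact: bsum_inj. Qed.

(** The real and imaginary parts are each split into positive and negative parts, whose finite sums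
    increase to a supremum. *)
Lemma asum_has_sum I (f : I -> C) : asum f -> exists s, has_sum f s.
Proof.
move=> hf.
have real_case (g : I -> R) : (forall i, `|g i| <= nm (f i)) ->
    exists s : C, has_sum (fun i => (g i)%:C%C) s.
  move=> gf.
  have [hp hn] : bsum (fun i => Num.max (g i) 0) /\
                 bsum (fun i => Num.max (- g i) 0).
    by split; apply: (bsum_le ler01 _ hf) => i; rewrite mul1r ge_max nm_ge0
      andbT; apply: le_trans (gf i); rewrite ?ler_norm // -normrN ler_norm.
  have pos (x : R) : 0 <= Num.max x 0 by rewrite le_max lexx orbT.
  have := has_sumB (has_sum_sup (fun i => pos _) hp)
                   (has_sum_sup (fun i => pos _) hn).
  set s := _ - _ => H; exists s; move: H; apply: eq_has_sum => i.
  rewrite -rmorphB /=; congr (_%:C)%C.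
  by case: (ltP (g i) 0) => h; [rewrite max_l | rewrite max_r]; lra.
have [|s hs] := real_case (fun i => complex.Re (f i)).
  by move=> i; case: (f i) => u v; rewrite /nm /= -sqrtr_sqr ler_wsqrtr ?lerDl
    ?sqr_ge0.
have [|t ht] := real_case (fun i => complex.Im (f i)).
  by move=> i; case: (f i) => u v; rewrite /nm /= -sqrtr_sqr ler_wsqrtr ?lerDr
    ?sqr_ge0.
exists (s + 'i%C * t).
apply: eq_has_sum (has_sumD hs (has_sumZ 'i%C ht)) => i.
by case: (f i) => u v; simpc.
Qed.

Lemma asum_usum I (f : I -> C) : asum f -> has_sum f (usum f).
Proof. by move=> /asum_has_sum [s hs]; rewrite (has_sum_usum hs). Qed.

Lemma asum_usummable I (f : I -> C) : asum f -> usummable f.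
Proof. by move=> /asum_usum; exact: has_sum_usummable. Qed.

(** Injectivity makes the preimage of a finite set finite. This is the common core of all
    reindexings, bijective ones and embeddings such as [nat] into [int]. *)
Lemma sum_preimage I J (V : zmodType) (h : J -> I) (f : I -> V) (A : {fset I}) :
  injective h -> (forall i, (forall j, h j <> i) -> f i = 0) ->
  exists2 B : {fset J}, (forall j, (j \in B) = (h j \in A)) &
    \sum_(i <- A) f i = \sum_(j <- B) f (h j).
Proof.
move=> hI f0.
have [B hB] : exists B : {fset J}, forall j, (j \in B) = (h j \in A).
  have fin : finite_set [set j | h j \in A].
    apply: (finite_preimage (f := h) (B := [set` A])).
      by move=> x y _ _ /hI.
    exact: finite_fset.
  exists (fset_set [set j | h j \in A]) => j; rewrite in_fset_set //.
  by apply/idP/idP => [/set_mem //|?]; apply/mem_set.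
exists B => //.
have <- : \sum_(i <- (h @` B)%fset) f i = \sum_(j <- B) f (h j).
  by rewrite big_imfset //= => x y _ _ /hI.
apply/esym/big_fset_incl.
  by apply/fsubsetP => i /imfsetP[j /=]; rewrite hB => ? ->.
move=> i iA iB; apply: f0 => j ji; move/negP: iB; apply.
by rewrite -ji; apply/imfsetP; exists j => //=; rewrite hB ji.
Qed.

Lemma bsum_extend I J (h : J -> I) (g : I -> R) :
  injective h -> (forall i, (forall j, h j <> i) -> g i = 0) ->
  bsum (g \o h) -> bsum g.
Proof.
move=> hI g0 [M hM]; exists M => A.
by have [B _ ->] := sum_preimage A hI g0; exact: hM.
Qed.

Lemma has_sum_inj I J (h : J -> I) (f : I -> C) s :
  injective h -> (forall i, (forall j, h j <> i) -> f i = 0) ->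
  has_sum (f \o h) s <-> has_sum f s.
Proof.
move=> hI f0; split=> /has_sumP hs; apply/has_sumP => e /hs [A hA].
  exists (h @` A)%fset => B AB.
  have [B' hB' ->] := sum_preimage B hI f0.
  apply: hA; apply/fsubsetP => j jA; rewrite hB'; apply: (fsubsetP AB).
  by apply/imfsetP; exists j.
have [A' hA' _] := sum_preimage A hI f0.
exists A' => B AB.
have [B' hB' sumE] := sum_preimage (A `|` h @` B)%fset hI f0.
suff -> : B = B' by rewrite -sumE; apply: hA; apply: fsubsetUl.
apply/fsetP => j; rewrite hB' inE -hA'; apply/idP/orP => [jB|[]].
- by right; apply/imfsetP; exists j.
- exact: (fsubsetP AB).
- by case/imfsetP=> j' /= ? /hI ->.
Qed.

(** The half of Fubini in which the double sum is known to converge: each inner sum is replaced by a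
    finite one, and the resulting finite set of pairs is large enough for the double sum. *)
Lemma has_sum_fiber I J (f : I * J -> C) (g : I -> C) s :
  has_sum f s -> (forall i, has_sum (fun j => f (i, j)) (g i)) -> has_sum g s.
Proof.
move=> /has_sumP hf hg; apply/has_sumP => e e0.
have e2 : 0 < e / 2 by lra.
have [A0 hA0] := hf _ e2.
exists [fset p.1 | p in A0]%fset => A AA.
(* The tolerance is shared among the fibres over [A]; the successor avoids dividing by zero when [A]
   is empty. *)
pose d := e / 2 / (#|` A|.+1)%:R.
have d0 : 0 < d by rewrite divr_gt0.
(* Each [B i] contains the second projection of [A0], so that the pairs built from [A] and [B]
   include [A0]. *)
have /choice [B hB] : forall i, exists B : {fset J},
    ([fset p.2 | p in A0] `<=` B)%fset /\ nm (g i - \sum_(j <- B) f (i, j)) < d.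
  move=> i; have /has_sumP /(_ d d0) [B hB] := hg i.
  exists (B `|` [fset p.2 | p in A0])%fset; split; first exact: fsubsetUr.
  by apply: hB; exact: fsubsetUl.
have := @pair_big_dep_cond _ _ _ _ _ A B xpredT (fun _ => xpredT)
  (fun i j => f (i, j)).
set D := imfset2 _ _ _ _ => sumE.
have /hA0 : (A0 `<=` D)%fset.
  apply/fsubsetP => -[i j] ij; apply/imfset2P; exists i => /=.
    rewrite !inE andbT; apply: (fsubsetP AA).
    by apply/imfsetP; exists (i, j).
  exists j => //; rewrite !inE andbT /=; apply: (fsubsetP (hB i).1).
  by apply/imfsetP; exists (i, j).
rewrite (eq_bigr (fun p : I * J => f (p.1, p.2))) => [|[] //].
rewrite -sumE => h1.
have -> : s - \sum_(i <- A) g i = (s - \sum_(i <- A) \sum_(j <- B i) f (i, j))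
    - \sum_(i <- A) (g i - \sum_(j <- B i) f (i, j)).
  by rewrite sumrB; ring.
apply: le_lt_trans (ler_nmB _ _) _.
suff : nm (\sum_(i <- A) (g i - \sum_(j <- B i) f (i, j))) <= e / 2 by lra.
apply: le_trans (ler_nm_sum _ _ _) _.
apply: (@le_trans _ _ (\sum_(i <- A) d)).
  by apply: ler_sum => i _; apply/ltW; case: (hB i).
rewrite big_const_seq count_predT iter_addr_0 -[d *+ _]mulr_natr.
rewrite /d -mulrA ler_piMr ?(ltW e2) // mulrC ler_pdivrMr // mul1r ler_nat.
exact: leqW.
Qed.

Lemma asum_mul I J (f : I -> C) (g : J -> C) :
  asum f -> asum g -> asum (fun p : I * J => f p.1 * g p.2).
Proof.
move=> [M hM] [N hN]; exists (M * N) => A.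
pose A1 := [fset p.1 | p in A]%fset; pose A2 := [fset p.2 | p in A]%fset.
have := @pair_big_dep_cond _ _ _ _ _ A1 (fun _ => A2) xpredT (fun _ => xpredT)
  (fun i j => nm (f i * g j)).
set D := imfset2 _ _ _ _ => sumE.
have AD : (A `<=` D)%fset.
  apply/fsubsetP => -[i j] ij; apply/imfset2P; exists i => /=.
    by rewrite !inE andbT; apply/imfsetP; exists (i, j).
  by exists j => //; rewrite !inE andbT /=; apply/imfsetP; exists (i, j).
apply: le_trans (ler_sum_fsub _ AD) _; first by move=> p; exact: nm_ge0.
rewrite -sumE.
have -> : \sum_(i <- A1) \sum_(j <- A2) nm (f i * g j) =
    (\sum_(i <- A1) nm (f i)) * (\sum_(j <- A2) nm (g j)).
  rewrite big_distrl; apply: eq_bigr => i _; rewrite big_distrr.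
  by apply: eq_bigr => j _; rewrite nmM.
by apply: ler_pM => //; apply: sumr_ge0 => *; apply: nm_ge0.
Qed.

Lemma has_sum_mul I J (f : I -> C) (g : J -> C) s t :
  asum f -> asum g -> has_sum f s -> has_sum g t ->
  has_sum (fun p : I * J => f p.1 * g p.2) (s * t).
Proof.
move=> af ag hf hg; have hfg := asum_usum (asum_mul af ag).
suff <- : usum (fun p : I * J => f p.1 * g p.2) = s * t by [].
apply: (@has_sum_unique _ (fun i => f i * t)).
  by apply: has_sum_fiber hfg _ => i; apply: has_sumZ.
rewrite mulrC; apply: eq_has_sum (has_sumZ t hf) => i.
by rewrite mulrC.
Qed.

Lemma has_sum_single I (f : I -> C) i0 :
  (forall i, i != i0 -> f i = 0) -> has_sum f (f i0).
Proof.
move=> f0; apply/has_sumP => e e0; exists [fset i0]%fset => B AB.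
suff -> : \sum_(i <- B) f i = f i0 by rewrite subrr nm0.
have <- : \sum_(i <- [fset i0]%fset) f i = f i0 by rewrite big_seq_fset1.
apply/esym/big_fset_incl => // i _.
by rewrite inE; exact: f0.
Qed.

(** Induction on [n], splitting off the first coordinate. Absolute summability is proved along with
    the value because the product of two sums requires it at each stage. *)
Lemma has_sum_ffun n (T : choiceType) (F : 'I_n -> T -> C) (S : 'I_n -> C) :
  (forall i, asum (F i)) -> (forall i, has_sum (F i) (S i)) ->
  asum (fun k : {ffun 'I_n -> T} => \prod_i F i (k i)) /\
  has_sum (fun k : {ffun 'I_n -> T} => \prod_i F i (k i)) (\prod_i S i).
Proof.
elim: n F S => [|n IH] F S hF hS.
  pose k0 : {ffun 'I_0 -> T} := ffun0 (card_ord 0).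
  have k0E k : k = k0 by apply/ffunP => -[].
  split.
    exists 1 => A; apply: (@le_trans _ _ (\sum_(k <- [fset k0]%fset) 1)).
      under eq_bigr do rewrite big_ord0 nm1.
      apply: ler_sum_fsub => //; apply/fsubsetP => k _.
      by rewrite inE (k0E k).
    by rewrite big_seq_fset1.
  have := @has_sum_single _ (fun k : {ffun 'I_0 -> T} => \prod_i F i (k i)) k0.
  by rewrite !big_ord0; apply => k; rewrite (k0E k) eqxx.
have [IH1 IH2] := IH (fun i => F (lift ord0 i)) (fun i => S (lift ord0 i))
  (fun i => hF _) (fun i => hS _).
have h1 := asum_mul (hF ord0) IH1.
have h2 := has_sum_mul (hF ord0) IH1 (hS ord0) IH2.
pose h (k : {ffun 'I_n.+1 -> T}) : T * {ffun 'I_n -> T} :=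
  (k ord0, [ffun i => k (lift ord0 i)]).
have hI : injective h.
  move=> k k' [k0 /ffunP kk]; apply/ffunP => i.
  case: (unliftP ord0 i) => [j|] -> //.
  by have := kk j; rewrite !ffunE.
have hS' p : exists k, h k = p.
  exists [ffun i => if unlift ord0 i is Some j then p.2 j else p.1].
  case: p => p1 p2; rewrite /h; congr (_, _); first by rewrite ffunE unlift_none.
  by apply/ffunP => i; rewrite !ffunE liftK.
have E k : F ord0 (h k).1 * \prod_i F (lift ord0 i) ((h k).2 i) =
    \prod_i F i (k i).
  by rewrite big_ord_recl; congr (_ * _); apply: eq_bigr => i _; rewrite ffunE.
have <- : (fun p : T * {ffun 'I_n -> T} =>
    F ord0 p.1 * \prod_i F (lift ord0 i) (p.2 i)) \o h =
    (fun k : {ffun 'I_n.+1 -> T} => \prod_i F i (k i)).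
  by apply/funext => k; exact: E.
split; first exact: asum_inj hI h1.
rewrite big_ord_recl; apply/(has_sum_inj _ hI); last exact: h2.
by move=> p; have [k <-] := hS' p => /(_ k).
Qed.

Lemma bsum_int (g : int -> R) :
  bsum (fun n => g (Posz n)) -> bsum (fun n => g (Negz n)) -> bsum g.
Proof.
move=> hp hn.
pose gp (n : int) := if n is Posz m then g n else 0.
pose gn (n : int) := if n is Negz m then g n else 0.
have [M hM] : bsum gp.
  apply: (@bsum_extend _ _ Posz) => //; first by move=> ? ? [].
  by case=> // n /(_ n).
have [N hN] : bsum gn.
  apply: (@bsum_extend _ _ Negz) => //; first by move=> ? ? [].
  by case=> // n /(_ n).
exists (M + N) => A.
have -> : \sum_(i <- A) g i = \sum_(i <- A) gp i + \sum_(i <- A) gn i.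
  by rewrite -big_split; apply: eq_bigr => -[] n _ /=; rewrite ?addr0 ?add0r.
exact: lerD.
Qed.

Lemma bsum_ratio (u : nat -> R) (c : R) n0 :
  (forall n, 0 <= u n) -> c < 1 ->
  (forall n, (n0 <= n)%N -> u n.+1 <= c * u n) -> bsum u.
Proof.
move=> u0 c1 hu.
exists (\sum_(i < n0) u i + u n0 / (1 - c)) => A.
(* Telescoping: the ratio bound gives [(1 - c) u_j <= u_j - u_(j+1)] for [j >= n0]. *)
have tail k : (1 - c) * \sum_(j < k) u (n0 + j)%N <= u n0 - u (n0 + k)%N.
  elim: k => [|k IH]; first by rewrite big_ord0 mulr0 addn0 subrr.
  rewrite big_ord_recr mulrDr addnS.
  by have := hu (n0 + k)%N (leq_addr _ _); rewrite /=; lra.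
have [N hN] : exists N, forall i, i \in A -> (i < n0 + N)%N.
  exists (\max_(i <- A) i).+1 => i iA.
  by rewrite addnS ltnS; apply: leq_trans (leq_addl _ _); exact: leq_bigmax_seq.
have le1 : \sum_(i <- A) u i <= \sum_(i < n0 + N) u i.
  rewrite -(big_mkord xpredT u) [X in _ <= X](bigID (mem A)) /=.
  rewrite -[X in _ <= X + _]big_filter.
  rewrite [X in X + _](perm_big (enum_fset A)) ?lerDl ?sumr_ge0 //=.
  apply: uniq_perm; rewrite ?filter_uniq ?iota_uniq ?fset_uniq //.
  move=> i; rewrite mem_filter mem_index_iota /=.
  by apply/andP/idP => [[]|iA] //; split => //; exact: hN.
apply: le_trans le1 _.
rewrite big_split_ord /= lerD2l ler_pdivlMr ?subr_gt0 // mulrC.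
by apply: le_trans (tail N) _; rewrite gerBl.
Qed.

(** Dominated convergence for series: a finite set carries all but a small part of the majorant, so
    the tails of all the [f n] are small simultaneously. *)
Lemma tannery I (f : nat -> I -> C) (g : I -> C) (M : I -> R) (s : nat -> K)
    (t : K) :
  bsum M -> (forall n i, nm (f n i) <= M i) ->
  (forall i, f^~ i @ \oo --> (g i : K)) ->
  (forall n, has_sum (f n) (s n)) -> has_sum g t -> s @ \oo --> t.
Proof.
move=> bM fM fg fs /has_sumP gt; apply/cvg_nmP => e e0.
have M0 i : 0 <= M i by apply: le_trans (nm_ge0 _) (fM 0%N i).
have e4 : 0 < e / 4 by lra.
have [A hA] : exists A : {fset I}, forall B : {fset I}, 
    \sum_(i <- (B `\` A)%fset) M i < e / 4.
  have [A hA] := (has_sumP _ _).1 (has_sum_sup M0 bM) _ e4.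
  have S_le := hA _ (fsubset_refl A).
  exists A => B.
  have := ler_sum_fsub M0 (fsubsetUl A B).
  have hS : has_sup (range (fun A : {fset I} => \sum_(i <- A) M i)).
    split; first by exists (\sum_(i <- (fset0 : {fset I})) M i), fset0.
    by case: bM => N hN; exists N => _ [D _ <-].
  have : \sum_(i <- (A `|` B)%fset) M i <=
      sup (range (fun A : {fset I} => \sum_(i <- A) M i)).
    by apply: ub_le_sup; [case: hS | exists (A `|` B)%fset].
  rewrite sum_fsetU.
  by move: S_le; rewrite -rmorph_sum -rmorphB nm_real /= ltr_norml; lra.
have [A' hA'] := gt _ e4.
pose D := (A `|` A')%fset.
have fin : (fun n => \sum_(i <- D) f n i) @ \oo -->
    (\sum_(i <- D) g i : K).
  elim: (enum_fset D) => [|i r IH].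
    rewrite big_nil (_ : (fun n => _) = fun=> 0); first exact: (cvg_cst (0 : K)).
    by apply/funext => n; rewrite big_nil.
  rewrite big_cons (_ : (fun n => _) =
    fun n => f n i + \sum_(j <- r) f n j); last first.
    by apply/funext => n; rewrite big_cons.
  exact: (@cvgD _ K _ _ _ _ _ _ _ (fg i) IH).
have /cvg_nmP /(_ _ e4) := fin; apply: filterS => n hn.
have gD : nm (t - \sum_(i <- D) g i) < e / 4 by apply: hA'; exact: fsubsetUr.
have [B hB] := (has_sumP _ _).1 (fs n) _ e4.
have sB : nm (s n - \sum_(i <- (D `|` B)%fset) f n i) < e / 4.
  by apply: hB; exact: fsubsetUr.
have tail : nm (\sum_(i <- (B `\` D)%fset) f n i) < e / 4.
  apply: le_lt_trans (ler_nm_sum _ _ _) _.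
  apply: le_lt_trans (hA B); apply: (@le_trans _ _
    (\sum_(i <- (B `\` D)%fset) M i)); first exact: ler_sum.
  by apply: ler_sum_fsub => //; apply: fsetDS; exact: fsubsetUl.
have E := sum_fsetU (f n) D B.
have -> : t - s n = (t - \sum_(i <- D) g i)
    + (\sum_(i <- D) g i - \sum_(i <- D) f n i)
    - \sum_(i <- (B `\` D)%fset) f n i
    - (s n - \sum_(i <- (D `|` B)%fset) f n i).
  by rewrite E; ring.
have := ler_nmB (t - \sum_(i <- D) g i
    + (\sum_(i <- D) g i - \sum_(i <- D) f n i)
    - \sum_(i <- (B `\` D)%fset) f n i)
    (s n - \sum_(i <- (D `|` B)%fset) f n i).
have := ler_nmB (t - \sum_(i <- D) g i
    + (\sum_(i <- D) g i - \sum_(i <- D) f n i))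
    (\sum_(i <- (B `\` D)%fset) f n i).
have := ler_nmD (t - \sum_(i <- D) g i)
    (\sum_(i <- D) g i - \sum_(i <- D) f n i).
by lra.
Qed.

End Absolute.
End Summation.
Arguments has_sumZ {R I} c {f s}.

(** * Roots of unity and uniqueness of Laurent coefficients *)

Section RootsOfUnity.
Variable R : realType.
Local Notation C := (complex R).
Local Open Scope ring_scope.

Lemma cexpD (u v : C) : cexp (u + v) = cexp u * cexp v.
Proof.
case: u v => [u1 u2] [v1 v2]; rewrite /cexp /=.
by rewrite expRD cosD sinD; simpc; congr Complex; ring.
Qed.

Lemma cexp0 : cexp 0 = 1 :> C.
Proof. by rewrite /cexp /= expR0 cos0 sin0; simpc. Qed.

Lemma cexp_natmul n (z : C) : cexp (n%:R * z) = cexp z ^+ n.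
Proof.
elim: n => [|n IH]; first by rewrite mul0r cexp0.
by rewrite exprSr -IH -cexpD; congr cexp; rewrite -natr1; ring.
Qed.

Lemma nm_cexp (z : C) : nm (cexp z) = expR (complex.Re z).
Proof.
rewrite /cexp nmM nm_real ger0_norm ?expR_ge0 //.
by rewrite /nm /= cos2Dsin2 sqrtr1 mulr1.
Qed.

(** With [theta = pi (i + 1) / r], the real part of the power is [1 - 2 sin(theta)^2], which differs
    from 1 because [0 < theta < pi] as long as [i + 1 < r]. *)
Lemma zeta_prim r : (0 < r)%N -> r.-primitive_root (zeta R r).
Proof.
move=> r0; have rR : (r%:R : R) != 0 by rewrite pnatr_eq0 -lt0n.
have zX k : zeta R r ^+ k =
    Complex (cos (2 * (pi * k%:R / r%:R))) (sin (2 * (pi * k%:R / r%:R))).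
  rewrite -cexp_natmul /cexp /zeta.
  have -> : k%:R * Complex 0 (2 * pi / r%:R) =
      Complex 0 (2 * (pi * k%:R / r%:R)) :> C.
    by rewrite -[k%:R](rmorph_nat (real_complex R)) /=; simpc; congr Complex; field.
  by rewrite /= expR0; simpc.
rewrite /primitive_root_of_unity r0; apply/forallP => i /=.
rewrite unity_rootE zX; apply/eqP; apply/eqP/eqP => [|->]; last first.
  rewrite mulfK // (_ : 2 * pi = pi *+ 2) ?cos2pi ?sin2pi //.
  by rewrite mulr_natl.
case => /eqP + _; apply: contra_eq => ir.
have : 0 < sin (pi * i.+1%:R / r%:R : R).
  apply: sin_gt0_pi; apply/andP; split.
    by rewrite !mulr_gt0 ?pi_gt0 ?ltr0n // invr_gt0 ltr0n.
  rewrite -mulrA gtr_pMr ?pi_gt0 // ltr_pdivrMr ?ltr0n // mul1r ltr_nat.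
  by rewrite ltn_neqAle ir ltn_ord.
move=> s0; rewrite mulr_natl cos_mulr2n cos2sin2.
have : 0 < sin (pi * i.+1%:R / r%:R : R) ^+ 2 by rewrite exprn_gt0.
by move=> ?; apply/eqP; lra.
Qed.

Lemma prim_root_inv (F : fieldType) n (z : F) :
  n.-primitive_root z -> n.-primitive_root z^-1.
Proof.
case/andP=> n0 /forallP h; rewrite /primitive_root_of_unity n0.
by apply/forallP => i; rewrite -(eqP (h i)) !unity_rootE exprVn invr_eq1.
Qed.

Lemma prod_1Bprim_root (F : fieldType) n (z y : F) : n.-primitive_root z ->
  \prod_(i < n) (1 - y * z ^+ i) = 1 - y ^+ n.
Proof.
move=> pz; have n0 := prim_order_gt0 pz.
have [->|y0] := eqVneq y 0.
  by rewrite expr0n gtn_eqF // subr0 big1 // => i _; rewrite mul0r subr0.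
(* The factorization of [X^n - 1] over the roots, evaluated at [y^-1] and scaled by [y^n]. *)
have /(congr1 (fun p => y ^+ n * p.[y^-1])) := factor_Xn_sub_1 pz.
rewrite big_mkord horner_prod !hornerE exprVn mulrBr divff ?expf_neq0 //.
rewrite mulr1 => <-.
have -> : y ^+ n = \prod_(i < n) y by rewrite prodr_const card_ord.
rewrite -big_split /=.
by apply: eq_bigr => i _; rewrite !hornerE mulrBr divff.
Qed.

Lemma nm_zeta r : nm (zeta R r) = 1.
Proof. by rewrite nm_cexp /= expR0. Qed.

Lemma zeta_neq0 r : zeta R r != 0.
Proof. by rewrite -nm_eq0 nm_zeta oner_eq0. Qed.

(* Discrete Fourier averaging over the M-th roots of unity keeps exactly the
   coefficients whose index is congruent to N modulo M. *)
Lemma laurent_unique (u : int -> C) :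
  (forall w, nm w = 1 -> has_sum (fun n : int => u n * w ^ n) 0) ->
  forall N, u N = 0.
Proof.
move=> hu N; apply/eqP; rewrite -nm_eq0 eq_le nm_ge0 andbT.
apply/ler_addgt0Pr => e e0; rewrite add0r.
have e4 : 0 < e / 4 by lra.
have hu1 : has_sum u 0.
  by apply: eq_has_sum (hu 1 (nm1 R)) => n; rewrite exp1rz mulr1.
have [A0 hA0] := (has_sumP _ _).1 hu1 _ e4.
pose A := (N |` A0)%fset.
have hA B : (A `<=` B)%fset -> nm (\sum_(i <- B) u i) < e / 4.
  move=> AB; rewrite -nmN -sub0r; apply: hA0; apply: fsubset_trans AB.
  exact: fsubsetUr.
(* [M] exceeds [|n - N|] on [A], so [N] is the only index of [A] in its class modulo [M]. *)
have [M M0 hM] : exists2 M : nat, (0 < M)%N &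
    forall n, n \in A -> (`|n - N| < M)%N.
  exists (\max_(n <- A) `|n - N|%N).+1 => // n nA; rewrite ltnS.
  exact: (@leq_bigmax_seq _ (enum_fset A) xpredT (fun n => `|n - N|%N) n nA isT).
pose w := zeta R M; have pw : M.-primitive_root w := zeta_prim M0.
have w0 : w != 0 := zeta_neq0 M.
(* The indicator of [n = N] modulo [M], written as an average so that the hypothesis applies at each
   root [w ^+ j]. *)
pose l n : C := M%:R^-1 * \sum_(j < M) (w ^ (n - N)) ^+ j.
have MC : (M%:R : C) != 0 by rewrite pnatr_eq0 -lt0n.
have hl : has_sum (fun n => l n * u n) 0.
  have h (j : 'I_M) : has_sum (fun n : int =>
      (M%:R^-1 * (w ^+ j) ^ (- N)) * (u n * (w ^+ j) ^ n)) 0.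
    rewrite -(mulr0 (M%:R^-1 * (w ^+ j) ^ (- N))); apply: has_sumZ.
    by apply: hu; rewrite nmX nm_zeta expr1n.
  have := has_sum_sum (r := index_enum 'I_M) h; rewrite big1 //.
  apply: eq_has_sum => n; rewrite /l mulrAC -mulrA big_distrr big_distrr /=.
  apply: eq_bigr => j _; rewrite mulrACA -mulrA; congr (_ * (_ * _)).
  rewrite -expfzDr ?expf_neq0 // addrC !exprnP.
  by rewrite !exprz_exp mulrC.
have lN : l N = 1.
  rewrite /l subrr expr0z; under eq_bigr do rewrite expr1n.
  by rewrite sumr_const card_ord mulVf.
have l01 n : l n = 1 \/ l n = 0.
  rewrite /l; set z := w ^ _; have zM : z ^+ M = 1.
    by rewrite exprnP exprz_exp mulrC -exprz_exp -exprnP prim_expr_order // exp1rz.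
  have [->|z1] := eqVneq z 1; [left|right].
    by under eq_bigr do rewrite expr1n; rewrite sumr_const card_ord mulVf.
  have := subrX1 z M; rewrite zM subrr => /esym/eqP.
  by rewrite mulf_eq0 subr_eq0 (negPf z1) /= => /eqP ->; rewrite mulr0.
have lA n : n \in A -> n != N -> l n = 0.
  move=> /hM nM nN; have [l1|//] := l01 n; exfalso.
  have zM : (w ^ (n - N)) ^+ M = 1.
    by rewrite exprnP exprz_exp mulrC -exprz_exp -exprnP prim_expr_order // exp1rz.
  have [z1|z1] := eqVneq (w ^ (n - N)) 1; last first.
    have := subrX1 (w ^ (n - N)) M; rewrite zM subrr => /esym/eqP.
    rewrite mulf_eq0 subr_eq0 (negPf z1) /= => /eqP s0.
    by move: l1; rewrite /l s0 mulr0 => /esym/eqP; rewrite oner_eq0.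
  have : w ^+ `|n - N|%N == 1.
    case: (n - N) z1 => k; first by move=> z1; apply/eqP; exact: z1.
    by rewrite NegzE -exprnN => /eqP; rewrite invr_eq1.
  rewrite -(prim_order_dvd pw) gtnNdvd // absz_gt0.
  by rewrite subr_eq0.
have [B0 hB0] := (has_sumP _ _).1 hl _ e4.
have hB : nm (\sum_(n <- (A `|` B0)%fset) l n * u n) < e / 4.
  by rewrite -nmN -sub0r; apply: hB0; exact: fsubsetUr.
have E1 : \sum_(n <- A) l n * u n = u N.
  have NA : N \in A by rewrite !inE eqxx.
  rewrite (big_fsetD1 N) //= lN mul1r big_seq big1 ?addr0 // => n.
  by rewrite !inE => /andP[nN nA]; rewrite lA ?mul0r // !inE.
(* The far indices congruent to [N]. The averaged sum makes [u N] plus the sum over [D] small; the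
   sum over [D] is small as the difference of the sums of [u] over the union of [A] and [D] and over
   [A]. *)
pose D := [fset n in (B0 `\` A)%fset | l n == 1]%fset.
have E2 : \sum_(n <- (B0 `\` A)%fset) l n * u n = \sum_(n <- D) u n.
  rewrite (big_fsetID _ (fun n => l n == 1)) /= -/D.
  rewrite [X in _ + X]big_seq [X in _ + X]big1 ?addr0; last first.
    by move=> n; rewrite !inE => /andP[_]; case: (l01 n) => -> ;
      rewrite ?eqxx ?mul0r.
  rewrite big_seq [RHS]big_seq; apply: eq_bigr => n; rewrite !inE.
  by move=> /andP[_ /eqP ->]; rewrite mul1r.
have E3 : \sum_(n <- (A `|` D)%fset) u n =
    \sum_(n <- A) u n + \sum_(n <- D) u n.
  rewrite sum_fsetU; congr (_ + _); apply: eq_fbigl => n; rewrite !inE.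
  by case: (n \in A0); case: (n == N); rewrite ?andbF ?andbT.
move: hB; rewrite sum_fsetU E1 E2 => hB.
have h1 := hA _ (fsubset_refl A); have h2 := hA _ (fsubsetUl A D).
have -> : u N = (u N + \sum_(n <- D) u n) -
    (\sum_(n <- (A `|` D)%fset) u n - \sum_(n <- A) u n) by rewrite E3; ring.
have := ler_nmB (u N + \sum_(n <- D) u n)
  (\sum_(n <- (A `|` D)%fset) u n - \sum_(n <- A) u n).
have := ler_nmB (\sum_(n <- (A `|` D)%fset) u n) (\sum_(n <- A) u n).
by lra.
Qed.

End RootsOfUnity.

(** * Convergence, nonvanishing and root-of-unity products of [(x;q)_oo] *)

Section InfiniteProducts.
Variable R : realType.
Local Notation C := (complex R).
Local Notation K := (Num.NumField.sort (C : numFieldType)).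
Local Open Scope classical_set_scope.
Local Open Scope ring_scope.

(** Supplies the rank from which the ratio tests below apply. *)
Lemma geom_small (rho D e : R) : 0 <= rho < 1 -> 0 < e ->
  exists n0 : nat, forall n : nat, (n0 <= n)%N -> D * rho ^+ n <= e.
Proof.
move=> /andP[r0 r1] e0; have D0 : 0 < `|D| + 1 by rewrite ltr_wpDl.
have := @cvg_expr R rho; rewrite ger0_norm // => /(_ r1).
move/cvgrPdist_lt => /(_ (e / (`|D| + 1))) [|n0 _ h]; first by rewrite divr_gt0.
exists n0 => n /h /=; rewrite sub0r normrN ger0_norm ?exprn_ge0 //.
rewrite ltr_pdivlMr // => hn.
apply: le_trans (_ : rho ^+ n * (`|D| + 1) <= e); last exact: ltW.
rewrite mulrC ler_wpM2l ?exprn_ge0 //; apply: le_trans (ler_norm D) _.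
by rewrite lerDl.
Qed.

Lemma has_sum_series (f : nat -> C) (s : C) :
  has_sum f s -> (fun n => \sum_(j < n) f j : K) @ \oo --> (s : K).
Proof.
move=> /has_sumP hf; apply/cvg_nmP => e /hf [A hA].
have [N hN] : exists N, forall i, i \in A -> (i < N)%N.
  exists (\max_(i <- A) i).+1 => i iA.
  by rewrite ltnS; exact: leq_bigmax_seq.
exists N => // n /= Nn.
have -> : \sum_(j < n) f j = \sum_(j <- [fset j in iota 0 n]%fset) f j.
  rewrite -(big_mkord xpredT f); apply: perm_big.
  apply: uniq_perm; rewrite ?iota_uniq ?fset_uniq // => j.
  by rewrite mem_index_iota inE /= mem_iota.
apply: hA; apply/fsubsetP => i /hN iN.
by rewrite inE /= mem_iota add0n (leq_trans iN).
Qed.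

Section ComplexSequences.
Implicit Types (u v : nat -> K) (l m : C).

Lemma ccvg_cst l : (fun _ : nat => l : K) @ \oo --> (l : K).
Proof. exact: cvg_cst. Qed.

Lemma ccvgM u v l m : u @ \oo --> (l : K) -> v @ \oo --> (m : K) ->
  (fun n => u n * v n) @ \oo --> (l * m : K).
Proof. by move=> hu hv; exact: (@cvgM K _ _ _ _ _ _ _ hu hv). Qed.

Lemma ccvgD u v l m : u @ \oo --> (l : K) -> v @ \oo --> (m : K) ->
  (fun n => u n + v n) @ \oo --> (l + m : K).
Proof. by move=> hu hv; exact: (@cvgD _ K _ _ _ _ _ _ _ hu hv). Qed.

Lemma ccvgB u v l m : u @ \oo --> (l : K) -> v @ \oo --> (m : K) ->
  (fun n => u n - v n) @ \oo --> (l - m : K).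
Proof. by move=> hu hv; exact: (@cvgB _ K _ _ _ _ _ _ _ hu hv). Qed.

Lemma cvgn_unique u l m : u @ \oo --> (l : K) -> u @ \oo --> (m : K) -> l = m.
Proof. exact: (@cvg_unique K (@norm_hausdorff _ _)). Qed.

End ComplexSequences.
Arguments ccvg_cst : clear implicits.

Section Fixed.
Variable q : C.
Hypothesis q1 : nm q < 1.

Lemma qpochnS x n : qpochn q x n.+1 = qpochn q x n * (1 - x * q ^+ n).
Proof. by rewrite /qpochn big_ord_recr. Qed.

Lemma qpochnSl x n : qpochn q x n.+1 = (1 - x) * qpochn q (x * q) n.
Proof.
rewrite /qpochn big_ord_recl mulr1; congr (_ * _); apply: eq_bigr => i _.
by rewrite -mulrA -exprS.
Qed.

Lemma nm_1B_le (x : C) (n : nat) : nm (1 - x * q ^+ n) <= 1 + nm x * nm q ^+ n.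
Proof. by apply: le_trans (ler_nmB _ _) _; rewrite nm1 nmM nmX. Qed.

Lemma nm_1B_ge (x : C) (n : nat) : 1 - nm x * nm q ^+ n <= nm (1 - x * q ^+ n).
Proof.
have := ler_nmD (1 - x * q ^+ n) (x * q ^+ n).
by rewrite subrK nm1 nmM nmX; lra.
Qed.

Lemma qpochn_cvgP x :
  exists l : C, (qpochn q x : nat -> K) @ \oo --> (l : K).
Proof.
have q0 := nm_ge0 q; have x0 := nm_ge0 x.
(* [t n] is the drop between consecutive partial products, so the product converges once the series
   of [t] does; the ratio [q (1 - x q^n)] tends to [q]. *)
pose t n := x * q ^+ n * qpochn q x n.
have q01 : 0 <= nm q < 1 by rewrite q0.
have [|n0 hn0] := geom_small (nm x) q01 (_ : 0 < (1 - nm q) / 2); first by lra.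
have at' : asum t.
  apply: (@bsum_ratio _ _ (nm q * (1 + (1 - nm q) / 2)) n0) => [n||n /hn0 hn].
  - exact: nm_ge0.
  - by nra.
  have -> : t n.+1 = q * (1 - x * q ^+ n) * t n.
    by rewrite /t qpochnS exprS; ring.
  rewrite nmM ler_wpM2r ?nm_ge0 // nmM ler_wpM2l //.
  by apply: le_trans (nm_1B_le _ _) _; rewrite lerD2l.
have [s /has_sum_series hs] := asum_has_sum at'.
exists (1 - s); rewrite (_ : (qpochn q x : nat -> K) =
  fun n => 1 - \sum_(j < n) t j).
  exact: (@ccvgB _ _ _ _ (ccvg_cst 1) hs).
apply/funext; elim=> [|n IH]; first by rewrite /qpochn !big_ord0 subr0.
by rewrite qpochnS big_ord_recr /= opprD addrA -IH /t; ring.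
Qed.

Lemma cvg_qpochn x : (qpochn q x : nat -> K) @ \oo --> (qpochoo q x : K).
Proof.
have [l hl] := qpochn_cvgP x.
suff -> : qpochoo q x = l by [].
exact: (@cvg_lim K (@norm_hausdorff _ _)).
Qed.

Arguments cvg_qpochn : clear implicits.

(* The reciprocals of the partial products converge too, so the limit cannot
   vanish. *)
Lemma qpochoo_neq0 x : (forall j, x * q ^+ j != 1) -> qpochoo q x != 0.
Proof.
move=> hx; have q0 := nm_ge0 q; have x0 := nm_ge0 x.
have hx' j : 1 - x * q ^+ j != 0 by rewrite subr_eq0 eq_sym.
have hP n : qpochn q x n != 0 by apply/prodf_neq0 => j _.
(* The increment between consecutive reciprocals. Once [|x| |q|^(n+1) <= (1 - |q|) / 2], its ratio
   is at most [2 |q| / (1 + |q|) < 1]. *)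
pose t n := x * q ^+ n * (qpochn q x n.+1)^-1.
have q01 : 0 <= nm q < 1 by rewrite q0.
have [|n0 hn0] := geom_small (nm x) q01 (_ : 0 < (1 - nm q) / 2); first by lra.
have at' : asum t.
  apply: (@bsum_ratio _ _ (nm q * 2 / (1 + nm q)) n0) => [n||n hn].
  - exact: nm_ge0.
  - by rewrite ltr_pdivrMr; lra.
  have -> : t n.+1 = q / (1 - x * q ^+ n.+1) * t n.
    rewrite /t [qpochn q x n.+2]qpochnS exprS; field.
    by rewrite hP -exprS hx'.
  rewrite nmM ler_wpM2r ?nm_ge0 // nmM nmV -mulrA ler_wpM2l //.
  have h1 := nm_1B_ge x n.+1; have h2 := hn0 _ (leqW hn).
  have h3 : (1 + nm q) / 2 <= nm (1 - x * q ^+ n.+1) by lra.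
  rewrite -[X in _ <= X]invrK lef_pV2 ?posrE; [|lra|].
    by rewrite invf_div.
  by rewrite invr_gt0 divr_gt0 //; lra.
have [s /has_sum_series hs] := asum_has_sum at'.
have hinv : (fun n => (qpochn q x n)^-1 : K) @ \oo --> (1 + s : K).
  rewrite (_ : (fun n => _) = fun n => 1 + \sum_(j < n) t j).
    exact: (@ccvgD _ _ _ _ (ccvg_cst 1) hs).
  apply/funext; elim=> [|n IH]; first by rewrite /qpochn !big_ord0 addr0 invr1.
  rewrite big_ord_recr /= addrA -IH /t qpochnS; field.
  by rewrite hP hx'.
have h1 := @ccvgM _ _ _ _ (cvg_qpochn x) hinv.
have : qpochoo q x * (1 + s) = 1.
  apply: (@cvgn_unique _ _ _ h1).
  rewrite (_ : (fun n => _) = fun=> 1); first exact: (ccvg_cst 1).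
  by apply/funext => n /=; rewrite mulfV.
by move=> h; apply/eqP => h0; move: h; rewrite h0 mul0r => /esym/eqP;
  rewrite oner_eq0.
Qed.

Lemma qpochooS x : qpochoo q x = (1 - x) * qpochoo q (x * q).
Proof.
have h1 := cvg_qpochn x; rewrite -cvg_shiftS in h1.
apply: (@cvgn_unique _ _ _ h1).
rewrite (_ : (fun n => _) = fun n => (1 - x) * qpochn q (x * q) n); last first.
  by apply/funext => n; rewrite qpochnSl.
exact: (@ccvgM _ _ _ _ (ccvg_cst (1 - x)) (cvg_qpochn _)).
Qed.

Lemma qpochoo_small_neq0 x : nm x < 1 -> qpochoo q x != 0.
Proof.
move=> x1; apply: qpochoo_neq0 => j; apply/eqP => /(congr1 (@nm R)).
rewrite nmM nmX nm1 => h.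
have := exprn_ile1 j (nm_ge0 q) (ltW q1).
by have := nm_ge0 x; have := exprn_ge0 j (nm_ge0 q); nra.
Qed.

End Fixed.
Arguments cvg_qpochn {q} q1 x.

(** For partial products the two products are exchanged and each power of [q] contributes one
    instance of [prod_1Bprim_root]; then the limit is taken. *)
Lemma prod_qpochoo (q x w : C) r : nm q < 1 -> r.-primitive_root w ->
  \prod_(i < r) qpochoo q (x * w ^+ i) = qpochoo (q ^+ r) (x ^+ r).
Proof.
move=> q1 pw; have r0 := prim_order_gt0 pw.
have qr1 : nm (q ^+ r) < 1 by rewrite nmX exprn_ilt1 ?nm_ge0 ?gtn_eqF.
have E n : qpochn (q ^+ r) (x ^+ r) n = \prod_(i < r) qpochn q (x * w ^+ i) n.
  rewrite /qpochn exchange_big; apply: eq_bigr => j _ /=.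
  rewrite exprAC -exprMn -(prod_1Bprim_root _ pw).
  by apply: eq_bigr => i _; rewrite mulrAC.
apply: esym; apply: (@cvgn_unique _ _ _ (cvg_qpochn qr1 _)).
rewrite (_ : qpochn _ _ =
  fun n => \prod_(i < r) qpochn q (x * w ^+ i) n); last first.
  by apply/funext.
elim: (index_enum _) => [|i s IH].
  rewrite big_nil (_ : (fun n => _) = fun=> 1); first exact: (ccvg_cst 1).
  by apply/funext => n; rewrite big_nil.
rewrite big_cons (_ : (fun n => _) = fun n => qpochn q (x * w ^+ i) n *
  \prod_(j <- s) qpochn q (x * w ^+ j) n); last first.
  by apply/funext => n; rewrite big_cons.
exact: (@ccvgM _ _ _ _ (cvg_qpochn q1 _) IH).
Qed.

End InfiniteProducts.
Arguments ccvg_cst : clear implicits.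
Arguments cvg_qpochn {R q} q1 x.

(** * Contiguous relations and majorants for the bilateral series *)

Section Ramanujan.
Variable R : realType.
Local Notation C := (complex R).
Local Notation K := (Num.NumField.sort (C : numFieldType)).
Local Open Scope classical_set_scope.
Local Open Scope ring_scope.

Variable q : C.
Hypotheses (q0 : q != 0) (q1 : nm q < 1).
Implicit Types (a b x z : C) (n : int).

Definition psi_term a b z n : C := qpoch q a n / qpoch q b n * z ^ n.

Lemma qpochN x (m : nat) :
  qpoch q x (- m%:Z) = (qpochn q (x * q ^- m) m)^-1.
Proof. by case: m => [|m] //=; rewrite /qpochn !big_ord0 invr1. Qed.

Lemma Negz_addr1 (m : nat) : Negz m + 1 = - m%:Z.
Proof. by rewrite NegzE -addn1 PoszD opprD addrNK. Qed.

Lemma qpochn_down x (m : nat) :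
  qpochn q (x * q ^- m.+1) m.+1 =
  (1 - x * q ^ (Negz m)) * qpochn q (x * q ^- m) m.
Proof.
rewrite qpochnSl NegzE -exprnN; congr (_ * qpochn _ _ _).
by rewrite exprSr invfM -!mulrA mulVf // mulr1.
Qed.

Lemma subr1_negexp_neq0 a : (forall j : nat, a != q ^+ j.+1) ->
  forall m, 1 - a * q ^ (Negz m) != 0.
Proof.
move=> ha m; rewrite subr_eq0 eq_sym NegzE -exprnN.
apply: contra (ha m) => /eqP h; apply/eqP.
by rewrite -[RHS]mul1r -h mulfVK ?expf_neq0.
Qed.

Lemma qpoch_succ a n : (forall j : nat, a != q ^+ j.+1) ->
  qpoch q a (n + 1) = qpoch q a n * (1 - a * q ^ n).
Proof.
move=> ha; case: n => m.
  by rewrite -PoszD addn1 /= qpochnS.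
rewrite Negz_addr1 qpochN /= qpochn_down invfM mulrAC mulVf ?mul1r //.
exact: subr1_negexp_neq0.
Qed.

(** Stated for the reciprocal, which at negative index is a finite product without exception, even
    where [qpoch] itself takes the default value 0. This covers [b = q]. *)
Lemma qpochV_succ b n : (forall j : nat, b * q ^+ j != 1) ->
  (qpoch q b n)^-1 = (qpoch q b (n + 1))^-1 * (1 - b * q ^ n).
Proof.
move=> hb; case: n => m.
  rewrite -PoszD addn1 /= qpochnS invfM mulfVK //.
  by rewrite subr_eq0 eq_sym.
by rewrite Negz_addr1 qpochN /= !invrK qpochn_down mulrC.
Qed.

Lemma qpochV_shift b n : (forall j : nat, b * q ^+ j != 1) ->
  (qpoch q (b * q) n)^-1 = (1 - b) * (qpoch q b (n + 1))^-1.
Proof.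
move=> hb; case: n => m.
  rewrite -PoszD addn1 /= qpochnSl invfM mulVKf //.
  by rewrite subr_eq0 eq_sym -[b]mulr1 -(expr0 q).
rewrite Negz_addr1 qpochN /= !invrK.
have -> : b * q * q ^- m.+1 = b * q ^- m.
  by rewrite exprS; field; rewrite q0 expf_neq0.
by rewrite qpochnS mulfVK ?expf_neq0 // mulrC.
Qed.

Lemma qpoch_shift a n : a != 1 ->
  qpoch q (a * q) n * (1 - a) = qpoch q a (n + 1).
Proof.
move=> a1; case: n => m.
  by rewrite -PoszD addn1 /= qpochnSl mulrC.
rewrite Negz_addr1 qpochN /=.
have -> : a * q * q ^- m.+1 = a * q ^- m.
  by rewrite exprS; field; rewrite q0 expf_neq0.
by rewrite qpochnS mulfVK ?expf_neq0 // invfM mulfVK // subr_eq0 eq_sym.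
Qed.

Lemma has_sum_shift (f : int -> C) s :
  has_sum f s -> has_sum (fun n => f (n + 1)) s.
Proof.
move=> h; apply/(@has_sum_inj _ _ _ (fun n : int => n + 1) f) => //.
  exact: addIr.
by move=> i /(_ (i - 1)); rewrite subrK.
Qed.

(** Termwise this is [a (1 - b q^n) - b (1 - a q^n) = a - b], combining the terms of index [n] and
    [n + 1]; a bilateral sum is unchanged by the shift of index. *)
Lemma psi_step_b a b z V U :
  a != 0 -> z != 0 ->
  (forall j : nat, a != q ^+ j.+1) -> (forall j : nat, b * q ^+ j != 1) ->
  has_sum (psi_term a b z) V -> has_sum (psi_term a (b * q) z) U ->
  V * (1 - b) * (1 - b / (a * z)) = (1 - b / a) * U.
Proof.
move=> a0 z0 ha hb hV hU.
have h1 := has_sumB (has_sumZ (a * (1 - b)) hV)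
  (has_sumZ (b * (1 - b) / z) (has_sum_shift hV)).
have h2 := has_sumZ (a - b) hU.
have E : a * (1 - b) * V - b * (1 - b) / z * V = (a - b) * U.
  apply: has_sum_unique h2; apply: eq_has_sum h1 => n.
  rewrite /psi_term qpochV_shift // [(qpoch q b n)^-1]qpochV_succ //.
  rewrite (qpoch_succ n ha) expfzDr // expr1z.
  by set B := (qpoch q b (n + 1))^-1; field.
apply: (mulfI a0); rewrite mulrA [in RHS]mulrA [X in _ = X * U]mulrBr.
rewrite [a * (b / a)]mulrC mulfVK // mulr1 -E; field.
by rewrite a0 z0.
Qed.

(** At [b = 0] the denominators are 1, and [(1 - a) (aq;q)_n = (a;q)_(n+1)] makes passing from [a]
    to [a q] a mere shift of index. *)
Lemma psi_step_a a z V W :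
  z != 0 -> a != 1 ->
  has_sum (psi_term a 0 z) V -> has_sum (psi_term (a * q) 0 z) W ->
  (1 - a) * z * W = V.
Proof.
move=> z0 a1 hV hW.
apply: (has_sum_unique (has_sumZ ((1 - a) * z) hW)).
apply: eq_has_sum (has_sum_shift hV) => n.
rewrite /psi_term -qpoch_shift // expfzDr // expr1z.
have B0 m : (qpoch q 0 m)^-1 = 1.
  by case: m => m; rewrite /= /qpochn big1 ?invr1 // => i _;
    rewrite !mul0r subr0.
by rewrite !B0; ring.
Qed.

(** In this form the powers of [q] cancel between numerator and denominator of a term of negative
    index. *)
Lemma qpochn_neg x (m : nat) :
  qpochn q (x * q ^- m) m = \prod_(i < m) ((q ^+ i.+1 - x) / q ^+ i.+1).
Proof.
elim: m => [|m IH]; first by rewrite /qpochn !big_ord0.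
rewrite qpochn_down big_ord_recr /= mulrC -IH; congr (_ * _).
by rewrite NegzE -exprnN mulrBl divff ?expf_neq0.
Qed.

Section Majorant.
Variables (A d t : R).
Hypotheses (A0 : 0 <= A) (d0 : 0 <= d) (d1 : d < 1) (t0 : 0 < t) (t1 : t < 1).

(** The bound sees [b] only through [|b| <= d], so it is uniform along [b q^n], as dominated
    convergence requires. *)
Definition pos_major (k : nat) : R :=
  \prod_(j < k) ((1 + A * nm q ^+ j) / (1 - d * nm q ^+ j) * t).

Lemma major_den j : 0 < 1 - d * nm q ^+ j.
Proof.
rewrite subr_gt0; apply: le_lt_trans d1; rewrite ler_piMr //.
by rewrite exprn_ile1 ?nm_ge0 // ltW.
Qed.

Lemma bsum_pos_major : bsum pos_major.
Proof.
have Q0 := nm_ge0 q; have q01 : 0 <= nm q < 1 by rewrite Q0.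
have F0 j : 0 <= (1 + A * nm q ^+ j) / (1 - d * nm q ^+ j) * t.
  rewrite mulr_ge0 ?(ltW t0) // divr_ge0 ?(ltW (major_den _)) //.
  by rewrite addr_ge0 // mulr_ge0 // exprn_ge0.
(* The ratio of the majorant tends to [t]; [c] lies midway between [t] and 1. *)
pose c := (1 + t) / 2; have t1' : 0 < 1 - t by rewrite subr_gt0.
have [|n0 hn0] := geom_small (A * t + c * d) q01 (_ : 0 < c - t).
  by rewrite /c; lra.
apply: (@bsum_ratio _ _ c n0) => [k||k /hn0 hk].
- by apply: prodr_ge0.
- by rewrite /c; lra.
rewrite /pos_major big_ord_recr /= mulrC ler_wpM2r ?prodr_ge0 //.
rewrite mulrAC ler_pdivrMr ?major_den //.
by move: hk; rewrite !mulrDl; nra.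
Qed.

Lemma nm_qpochn_le a k : nm a <= A ->
  nm (qpochn q a k) <= \prod_(j < k) (1 + A * nm q ^+ j).
Proof.
move=> aA; rewrite nm_prod; apply: ler_prod => j _; rewrite nm_ge0 /=.
apply: le_trans (nm_1B_le _ _ _) _.
by rewrite lerD2l ler_wpM2r // exprn_ge0 // nm_ge0.
Qed.

Lemma nm_qpochn_ge b k : nm b <= d ->
  \prod_(j < k) (1 - d * nm q ^+ j) <= nm (qpochn q b k).
Proof.
move=> bd; rewrite nm_prod; apply: ler_prod => j _.
rewrite ltW ?major_den //=; apply: le_trans (nm_1B_ge _ _ _).
by rewrite lerD2l lerN2 ler_wpM2r // exprn_ge0 // nm_ge0.
Qed.

Lemma pos_majorP a b z k : nm a <= A -> nm b <= d -> nm z = t ->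
  nm (qpochn q a k / qpochn q b k * z ^+ k) <= pos_major k.
Proof.
move=> aA bd zt; rewrite /pos_major !big_split /= prodr_const card_ord.
rewrite prodfV nmM nmX zt nmM nmV ler_wpM2r ?exprn_ge0 ?(ltW t0) //.
apply: ler_pM; rewrite ?invr_ge0 ?nm_ge0 ?nm_qpochn_le //.
have D0 : 0 < \prod_(j < k) (1 - d * nm q ^+ j).
  by apply: prodr_gt0 => j _; exact: major_den.
by rewrite lef_pV2 ?posrE ?nm_qpochn_ge // (lt_le_trans D0) ?nm_qpochn_ge.
Qed.

Variable a : C.
Hypotheses (a0 : a != 0) (ha : forall j : nat, a != q ^+ j.+1).
Hypothesis (dat : d < nm a * t).

(** The factors tend to [d / (|a| t)], which is where [d < |a| t], the inner edge of the annulus, is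
    needed. *)
Definition neg_major (k : nat) : R :=
  \prod_(j < k) ((nm q ^+ j.+1 + d) / nm (q ^+ j.+1 - a) / t).

Lemma bsum_neg_major : bsum (fun k => neg_major k.+1).
Proof.
have Q0 := nm_ge0 q; have q01 : 0 <= nm q < 1 by rewrite Q0.
have N0 j : 0 < nm (q ^+ j.+1 - a) by rewrite nm_gt0 subr_eq0 eq_sym.
have F0 j : 0 <= (nm q ^+ j.+1 + d) / nm (q ^+ j.+1 - a) / t.
  by rewrite !divr_ge0 ?(ltW t0) ?nm_ge0 // addr_ge0 // exprn_ge0.
have at0 : 0 < nm a * t by rewrite mulr_gt0 // nm_gt0.
pose c := (d / (nm a * t) + 1) / 2.
have dc : d / (nm a * t) < 1 by rewrite ltr_pdivrMr // mul1r.
have dc0 : 0 <= d / (nm a * t) by rewrite divr_ge0 // ltW.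
have cd : d < c * (nm a * t) by rewrite -ltr_pdivrMr // /c; lra.
have [|n0 hn0] := geom_small (1 + c * t) q01 (_ : 0 < c * (nm a * t) - d).
  by lra.
apply: (@bsum_ratio _ _ c n0) => [k||k hk].
- by apply: prodr_ge0.
- by rewrite /c; lra.
rewrite {1}/neg_major big_ord_recr /= mulrC ler_wpM2r ?prodr_ge0 //.
rewrite ler_pdivrMr // ler_pdivrMr //.
have h1 : nm a - nm q ^+ k.+2 <= nm (q ^+ k.+2 - a).
  have := ler_nmB (q ^+ k.+2) (q ^+ k.+2 - a).
  by rewrite opprB addrC subrK nmX; lra.
have h2 := hn0 _ (leqW (leqW hk)).
have c0 : 0 <= c * t by rewrite mulr_ge0 ?(ltW t0) // /c; lra.
have := ler_wpM2l c0 h1; rewrite mulrBr; move: h2; rewrite mulrDl mul1r; nra.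
Qed.

Lemma neg_majorP b z k : nm b <= d -> nm z = t ->
  nm (psi_term a b z (Negz k)) <= neg_major k.+1.
Proof.
move=> bd zt.
have -> : psi_term a b z (Negz k) =
    \prod_(i < k.+1) ((q ^+ i.+1 - b) / (q ^+ i.+1 - a)) * z ^- k.+1.
  rewrite /psi_term /= invrK !qpochn_neg NegzE -exprnN -prodfV -big_split /=.
  congr (_ * _); apply: eq_bigr => i _; field.
  by rewrite expf_neq0 // subr_eq0 eq_sym ha.
rewrite nmM nmV nmX zt /neg_major [X in _ <= X]big_split /= prodr_const card_ord exprVn.
rewrite ler_wpM2r ?invr_ge0 ?exprn_ge0 ?(ltW t0) // nm_prod.
apply: ler_prod => j _; rewrite nm_ge0 /= nmM nmV.
rewrite ler_wpM2r ?invr_ge0 ?nm_ge0 //.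
by apply: le_trans (ler_nmB _ _) _; rewrite nmX lerD2l.
Qed.

End Majorant.

End Ramanujan.

(** * The q-binomial theorem and Ramanujan's 1psi1 sum *)

Section RamanujanSum.
Variable R : realType.
Local Notation C := (complex R).
Local Notation K := (Num.NumField.sort (C : numFieldType)).
Local Open Scope classical_set_scope.
Local Open Scope ring_scope.

Variable q : C.
Hypotheses (q0 : q != 0) (q1 : nm q < 1).
Implicit Types (a b x z : C).

Lemma nmq_ge0_lt1 : 0 <= nm q < 1.
Proof. by rewrite nm_ge0. Qed.

Lemma asum_psi a b z :
  a != 0 -> (forall j : nat, a != q ^+ j.+1) ->
  (forall j : nat, b * q ^+ j != 1) -> nm (b / a) < nm z < 1 ->
  asum (psi_term q a b z).
Proof.
move=> a0 ha hb /andP[baz z1].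
have a0' : 0 < nm a by rewrite nm_gt0.
have z0 : 0 < nm z by apply: le_lt_trans (nm_ge0 _) baz.
have dat : nm b < nm a * nm z.
  by move: baz; rewrite nmM nmV ltr_pdivrMr // mulrC.
apply: bsum_int; last first.
  apply: (bsum_le ler01) (bsum_neg_major q1 (nm_ge0 b) z0 a0 ha dat) => k.
  by rewrite mul1r; apply: neg_majorP.
have a0'' := ltW a0'; have b0 := nm_ge0 b.
(* [pos_major] would require [|b| < 1], which is not assumed, so the nonnegative indices get a
   direct ratio test. *)
pose c := (1 + nm z) / 2.
have z1' : 0 < 1 - nm z by rewrite subr_gt0.
have [|n0 hn0] := geom_small (nm a * nm z + c * nm b) nmq_ge0_lt1 (_ : 0 < c - nm z).
  by rewrite /c; lra.
apply: (@bsum_ratio _ _ c n0) => [k||k /hn0 hk].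
- exact: nm_ge0.
- by rewrite /c; lra.
have hb' : 1 - b * q ^+ k != 0 by rewrite subr_eq0 eq_sym.
have -> : psi_term q a b z k.+1 =
    psi_term q a b z k * (z * ((1 - a * q ^+ k) / (1 - b * q ^+ k))).
  rewrite /psi_term /= !qpochnS invfM -!exprnP exprSr.
  by set B := (qpochn q b k)^-1; field.
rewrite nmM mulrC ler_wpM2r ?nm_ge0 // !nmM nmV mulrA ler_pdivrMr ?nm_gt0 //.
have h1 := nm_1B_le q a k; have h2 := nm_1B_ge q b k.
have c0 : 0 <= c by rewrite /c; lra.
have h3 := ler_wpM2l (ltW z0) h1; have h4 := ler_wpM2l c0 h2.
by move: hk; rewrite mulrDl; lra.
Qed.

Lemma cvg_geom x : (fun n => x * q ^+ n : K) @ \oo --> (0 : K).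
Proof.
apply/cvg_nmP => e e0.
have e2 : 0 < e / 2 by lra.
have [n0 hn0] := geom_small (nm x) nmq_ge0_lt1 e2.
exists n0 => // n /= /hn0; rewrite sub0r nmN nmM nmX; lra.
Qed.

Lemma cvg_qpochn_arg (u : nat -> K) (l : C) m :
  u @ \oo --> (l : K) ->
  (fun n => qpochn q (u n) m : K) @ \oo --> (qpochn q l m : K).
Proof.
move=> ul; elim: m => [|m IH].
  rewrite /qpochn big_ord0 (_ : (fun n => _) = fun=> 1); first exact: (ccvg_cst _ 1).
  by apply/funext => n; rewrite big_ord0.
rewrite qpochnS (_ : (fun n => _) =
  fun n => qpochn q (u n) m * (1 - u n * q ^+ m)); last first.
  by apply/funext => n; rewrite qpochnS.
apply: ccvgM IH _; apply: ccvgB (ccvg_cst _ 1) _.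
by apply: ccvgM ul (ccvg_cst _ _).
Qed.

Lemma qpochn0 m : qpochn q 0 m = 1.
Proof. by rewrite /qpochn big1 // => i _; rewrite mul0r subr0. Qed.

Lemma ccvgV (u : nat -> K) (l : C) : l != 0 -> u @ \oo --> (l : K) ->
  (fun n => (u n)^-1) @ \oo --> (l^-1 : K).
Proof. by move=> l0 ul; exact: (@cvgV K _ _ _ _ _ l0 ul). Qed.

Lemma cvg_psi_term a b z n :
  (fun m => psi_term q a (b * q ^+ m) z n : K) @ \oo --> (psi_term q a 0 z n : K).
Proof.
apply: ccvgM (ccvg_cst _ _); apply: ccvgM (ccvg_cst _ _) _.
case: n => n /=.
  by apply: ccvgV; [rewrite qpochn0 oner_eq0 | apply: cvg_qpochn_arg; exact: cvg_geom].
rewrite invrK (_ : (fun m => _) =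
  fun m => qpochn q (b * q ^- n.+1 * q ^+ m) n.+1); last first.
  by apply/funext => m; rewrite invrK mulrAC.
rewrite mul0r; apply: cvg_qpochn_arg; exact: cvg_geom.
Qed.

Definition psi a b z : C := usum (psi_term q a b z).

Lemma cvg_psi a b z :
  a != 0 -> (forall j : nat, a != q ^+ j.+1) ->
  (forall j : nat, b * q ^+ j != 1) -> nm (b / a) < nm z < 1 ->
  (fun n => psi a (b * q ^+ n) z : K) @ \oo --> (psi a 0 z : K).
Proof.
move=> a0 ha hb /andP[baz z1].
have z0 : 0 < nm z by apply: le_lt_trans (nm_ge0 _) baz.
have a0' : 0 < nm a by rewrite nm_gt0.
have y0 : 0 < nm a * nm z by rewrite mulr_gt0.
(* This [d] lies below both 1 and [|a| |z|], as the two majorants require; [|b q^n| <= d] holds from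
   [n0] on, hence the shift of the sequence. *)
set y := nm a * nm z in y0; pose d := y / (1 + y).
have d0 : 0 < d by rewrite divr_gt0 // addr_gt0.
have d1 : d < 1 by rewrite ltr_pdivrMr; lra.
have dy : d < y by rewrite ltr_pdivrMr; nra.
have [n0 hn0] := geom_small (nm b) nmq_ge0_lt1 d0.
pose M (n : int) := match n with
  | Posz k => pos_major q (nm a) d (nm z) k
  | Negz k => neg_major q d (nm z) a k.+1 end.
rewrite -(cvg_shiftn n0).
apply: (@tannery _ _ (fun n => psi_term q a (b * q ^+ (n + n0)) z)
  (psi_term q a 0 z) M).
- apply: bsum_int; first exact: (bsum_pos_major q1 (nm_ge0 a) (ltW d0) d1 z0 z1).
  exact: (bsum_neg_major q1 (ltW d0) z0 a0 ha dy).
- move=> n i; have bd : nm (b * q ^+ (n + n0)) <= d.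
    by rewrite nmM nmX; apply: hn0; exact: leq_addl.
  case: i => k.
    exact: (pos_majorP q1 (ltW d0) d1 z0 k (lexx _) bd erefl).
  exact: (neg_majorP q0 z0 ha k bd erefl).
- move=> i; have := @cvg_psi_term a b z i.
  by rewrite -(cvg_shiftn n0).
- move=> n; apply: asum_usum; apply: asum_psi => //.
    by move=> j; rewrite -mulrA -exprD.
  rewrite z1 andbT; apply: le_lt_trans baz.
  rewrite !nmM mulrAC ler_piMr ?mulr_ge0 ?nm_ge0 // nmX.
  by rewrite exprn_ile1 ?nm_ge0 // ltW.
- apply: asum_usum; apply: asum_psi => //.
    by move=> j; rewrite mul0r eq_sym oner_eq0.
  by rewrite mul0r nm0 z0 z1.
Qed.

Section QBinomial.
Variable z : C.
Hypothesis z1 : nm z < 1.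

Definition bin_term a (k : nat) : C := qpochn q a k / qpochn q q k * z ^+ k.

Lemma qpochn_q_neq0 k : qpochn q q k != 0.
Proof.
apply/prodf_neq0 => j _; rewrite -exprS subr_eq0; apply/eqP => h.
have : nm (q ^+ j.+1) < 1 by rewrite nmX exprn_ilt1 ?nm_ge0.
by rewrite -h nm1 ltxx.
Qed.

Lemma asum_bin_term a : asum (bin_term a).
Proof.
have [z0|z0] := eqVneq z 0.
  apply: (@bsum_ratio _ _ 0 0) => [n||n _]; rewrite ?nm_ge0 ?ltr01 //.
  by rewrite /bin_term exprS z0 mul0r mulr0 nm0 mul0r.
have z0' : 0 < nm z by rewrite nm_gt0.
apply: (bsum_le ler01)
  (bsum_pos_major q1 (nm_ge0 a) (nm_ge0 q) q1 z0' z1) => k.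
by rewrite mul1r; apply: pos_majorP; rewrite ?nm_ge0.
Qed.

Lemma bin_term_step a k :
  bin_term a k.+1 = bin_term (a * q) k.+1 - a * z * bin_term (a * q) k.
Proof.
have := qpochn_q_neq0 k.+1; rewrite qpochnS mulf_eq0 => /norP[k0 k1].
rewrite /bin_term qpochnSl !qpochnS exprS; field.
by rewrite k0 k1.
Qed.

Definition bin a : C := usum (bin_term a).

Lemma has_sum_bin a : has_sum (bin_term a) (bin a).
Proof. exact/asum_usum/asum_bin_term. Qed.
Arguments has_sum_bin : clear implicits.

(** Coefficientwise this rests on [(1 - a q^(k+1)) - a (1 - q^(k+1)) = 1 - a]. *)
Lemma bin_step a : bin a = (1 - a * z) * bin (a * q).
Proof.
pose g (k : nat) := if k is j.+1 then bin_term (a * q) j else 0.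
have hg : has_sum g (bin (a * q)).
  apply/(has_sum_inj (h := succn)); [by move=> ? ? []| |exact: has_sum_bin].
  by case=> // i /(_ i).
have h := has_sumB (has_sum_bin (a * q)) (has_sumZ (a * z) hg).
rewrite mulrBl mul1r; apply: has_sum_unique (has_sum_bin a) _.
apply: eq_has_sum h => -[|k] /=; last by rewrite (bin_term_step a).
by rewrite mulr0 subr0 /bin_term /qpochn !big_ord0.
Qed.

Lemma bin_iter a n : bin a = qpochn q (a * z) n * bin (a * q ^+ n).
Proof.
elim: n => [|n IH]; first by rewrite mulr1 /qpochn big_ord0 mul1r.
by rewrite IH bin_step qpochnS exprSr [LHS]mulrA mulrAC [in LHS]mulrAC
  [a * z * _]mulrAC [a * (_ * q)]mulrA.
Qed.

Lemma cvg_bin a : (fun n => bin (a * q ^+ n) : K) @ \oo --> (bin 0 : K).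
Proof.
have [z0|z0] := eqVneq z 0.
  suff E x : bin x = 1 by under eq_fun do rewrite E; rewrite E; exact: ccvg_cst.
  have hs : has_sum (bin_term x) (bin_term x 0).
    apply: has_sum_single => -[//|k] _.
    by rewrite /bin_term exprS z0 mul0r mulr0.
  rewrite (has_sum_unique (has_sum_bin x) hs).
  by rewrite /bin_term /qpochn !big_ord0 invr1 !mulr1.
have z0' : 0 < nm z by rewrite nm_gt0.
apply: (@tannery _ _ (fun n => bin_term (a * q ^+ n)) (bin_term 0)
  (pos_major q (nm a) (nm q) (nm z))).
- exact: (bsum_pos_major q1 (nm_ge0 a) (nm_ge0 q) q1 z0' z1).
- move=> n k; apply: pos_majorP; rewrite ?nm_ge0 //.
  by rewrite nmM nmX ler_piMr ?nm_ge0 // exprn_ile1 ?nm_ge0 // ltW.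
- move=> k; apply: ccvgM (ccvg_cst _ _); apply: ccvgM (ccvg_cst _ _).
  apply: cvg_qpochn_arg; exact: cvg_geom.
- by move=> n; exact: has_sum_bin.
- exact: has_sum_bin.
Qed.

Lemma bin_prod a : bin a = qpochoo q (a * z) * bin 0.
Proof.
have h := ccvgM (cvg_qpochn q1 (a * z)) (cvg_bin a).
apply: (cvgn_unique _ h).
rewrite (_ : (fun n => _) = fun=> bin a); first exact: ccvg_cst.
by apply/funext => n; rewrite -bin_iter.
Qed.

(** The unknown constant [bin 0] is read off at [a = 1], where the series reduces to its first
    term. *)
Lemma q_binomial a : bin a * qpochoo q z = qpochoo q (a * z).
Proof.
have b1 : bin 1 = 1.
  have hs : has_sum (bin_term 1) (bin_term 1 0).
    apply: has_sum_single => -[//|k] _.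
    by rewrite /bin_term qpochnSl subrr !mul0r.
  rewrite (has_sum_unique (has_sum_bin 1) hs).
  by rewrite /bin_term /qpochn !big_ord0 invr1 !mulr1.
have := bin_prod 1; rewrite b1 mul1r => h.
by rewrite (bin_prod a) -mulrA [bin 0 * _]mulrC -h mulr1.
Qed.

End QBinomial.

(** At [b = q] each reciprocal [1 / (q;q)_n] with [n < 0] contains the factor [1 - 1], so only the
    unilateral series remains. *)
Lemma psi_bin a z : nm z < 1 -> psi a q z = bin z a.
Proof.
move=> z1; apply: has_sum_usum.
apply/(has_sum_inj (h := Posz)); [by move=> ? ? []| |].
  case=> [n /(_ n) //|m _].
  rewrite /psi_term /= invrK [X in _ * X * _](_ : _ = 0) ?mulr0 ?mul0r //.
  have E : q * q ^- m.+1 * q ^+ m = 1.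
    by rewrite exprS; field; rewrite q0 expf_neq0.
  by rewrite qpochnS E subrr mulr0.
exact: has_sum_bin.
Qed.

Lemma has_sum_psi a b z :
  a != 0 -> (forall j : nat, a != q ^+ j.+1) ->
  (forall j : nat, b * q ^+ j != 1) -> nm (b / a) < nm z < 1 ->
  has_sum (psi_term q a b z) (psi a b z).
Proof. by move=> a0 ha hb hz; apply/asum_usum/asum_psi. Qed.

Lemma psi_to_0 a b z :
  a != 0 -> (forall j : nat, a != q ^+ j.+1) ->
  (forall j : nat, b * q ^+ j != 1) -> nm (b / a) < nm z < 1 ->
  psi a b z * qpochoo q b * qpochoo q (b / (a * z)) =
  qpochoo q (b / a) * psi a 0 z.
Proof.
move=> a0 ha hb hz.
have z0 : z != 0.
  by case/andP: hz => h _; rewrite -nm_gt0; apply: le_lt_trans h; exact: nm_ge0.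
have hbn n j : b * q ^+ n * q ^+ j != 1 by rewrite -mulrA -exprD.
have hzn n : nm (b * q ^+ n / a) < nm z < 1.
  case/andP: hz => h ->; rewrite andbT; apply: le_lt_trans h.
  rewrite !nmM mulrAC ler_piMr ?mulr_ge0 ?nm_ge0 // nmX.
  by rewrite exprn_ile1 ?nm_ge0 // ltW.
have E n : psi a b z * qpochn q b n * qpochn q (b / (a * z)) n =
    qpochn q (b / a) n * psi a (b * q ^+ n) z.
  elim: n => [|n IH]; first by rewrite mulr1 /qpochn !big_ord0 !mulr1 mul1r.
  rewrite !qpochnS; have := psi_step_b q0 a0 z0 ha (hbn n)
    (has_sum_psi a0 ha (hbn n) (hzn n)) (has_sum_psi a0 ha _ _).
  rewrite -mulrA -exprSr => /(_ (hbn n.+1) (hzn n.+1)) S.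
  have -> : psi a b z * (qpochn q b n * (1 - b * q ^+ n)) *
      (qpochn q (b / (a * z)) n * (1 - b / (a * z) * q ^+ n)) =
      (psi a b z * qpochn q b n * qpochn q (b / (a * z)) n) *
      (1 - b * q ^+ n) * (1 - b * q ^+ n / (a * z)).
    by rewrite [b / _ * _]mulrAC; ring.
  rewrite IH; transitivity (qpochn q (b / a) n * (psi a (b * q ^+ n) z *
    (1 - b * q ^+ n) * (1 - b * q ^+ n / (a * z)))); first by ring.
  by rewrite S [b / a * _]mulrAC; ring.
have h1 := ccvgM (ccvgM (ccvg_cst _ (psi a b z)) (cvg_qpochn q1 b))
  (cvg_qpochn q1 (b / (a * z))).
have h2 := ccvgM (cvg_qpochn q1 (b / a)) (cvg_psi a0 ha hb hz).
apply: (cvgn_unique h1); rewrite (_ : (fun n => _) =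
  fun n => qpochn q (b / a) n * psi a (b * q ^+ n) z) //.
by apply/funext => n; exact: E.
Qed.

Lemma psi_b0 a z : a != 0 -> z != 0 -> nm z < 1 ->
  (forall j : nat, a != q ^+ j.+1) ->
  psi a 0 z * qpochoo q (q / a) * qpochoo q z =
  qpochoo q q * qpochoo q (a * z) * qpochoo q (q / (a * z)).
Proof.
move=> a0 z0 z1 ha.
have z0' : 0 < nm z by rewrite nm_gt0.
have a0' : 0 < nm a by rewrite nm_gt0.
(* [m] bounds the number of replacements of [a] by [a / q] needed to reach [|q / a| < |z|], the
   domain where [b = q] is allowed. *)
have [m] : exists m : nat, nm q ^+ m.+1 < nm a * nm z.
  have [|n hn] := geom_small 1 nmq_ge0_lt1 (_ : 0 < (nm a * nm z) / 2).
    by rewrite divr_gt0 ?mulr_gt0.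
  exists n; have := hn _ (leqnSn n); rewrite mul1r => h.
  by apply: le_lt_trans h _; rewrite ltr_pdivrMr // ltr_pMr ?mulr_gt0 // ltr1n.
elim: m a a0 a0' ha => [|m IH] a a0 a0' ha hm.
  have hq j : q * q ^+ j != 1.
    rewrite -exprS; apply/eqP => h.
    have : nm (q ^+ j.+1) < 1 by rewrite nmX exprn_ilt1 ?nm_ge0.
    by rewrite h nm1 ltxx.
  have hz : nm (q / a) < nm z < 1.
    by rewrite z1 andbT nmM nmV ltr_pdivrMr // mulrC -[nm q]expr1.
  have := psi_to_0 a0 ha hq hz; rewrite psi_bin // => h.
  have h2 := q_binomial z1 a.
  rewrite [psi a 0 z * _]mulrC -h -h2; ring.
have a1 : a / q != 1.
  by apply: contra (ha 0%N) => /eqP h; rewrite expr1 -[a](mulfVK q0) h mul1r.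
have aq0 : a / q != 0 by rewrite mulf_neq0 ?invr_eq0.
have haq j : a / q != q ^+ j.+1.
  apply: contra (ha j.+1) => /eqP h; apply/eqP.
  by rewrite -[LHS](mulfVK q0) h -exprSr.
have q0' : 0 < nm q by rewrite nm_gt0.
have aq0' : 0 < nm (a / q) by rewrite nm_gt0.
have := IH (a / q) aq0 aq0' haq.
have -> : nm (a / q) * nm z = nm a * nm z / nm q by rewrite nmM nmV mulrAC.
rewrite ltr_pdivlMr // -exprSr => /(_ hm).
have h0 j : (0 : C) * q ^+ j != 1 by rewrite mul0r eq_sym oner_eq0.
have hz c : nm (0 / c) < nm z < 1 by rewrite mul0r nm0 z0' z1.
have hS := psi_step_a q0 z0 a1 (has_sum_psi aq0 haq h0 (hz _)).
have := has_sum_psi a0 ha h0 (hz _).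
rewrite -{1}[a](mulfVK q0) => /hS <-.
rewrite [qpochoo q (q / a)](qpochooS q1) [qpochoo q (a / q * z)](qpochooS q1).
rewrite [qpochoo q (q / (a * z))](qpochooS q1).
have -> : q / (a / q) = q / a * q by field; rewrite a0.
have -> : a / q * z * q = a * z by field.
have -> : q / (a / q * z) = q / (a * z) * q by field; rewrite a0 z0.
(* Multiplication by [- a z / q] turns [1 - q / a] into [(1 - a / q) z] and [1 - q / (a z)] into
   [1 - a z / q]. *)
move=> h; have c0 : - (a * z / q) != 0.
  by rewrite oppr_eq0 !mulf_neq0 ?invr_eq0.
apply: (mulfI c0).
transitivity ((1 - a / q) * z * psi a 0 z * qpochoo q (q / a * q) * qpochoo q z).
  by field; rewrite ?a0 ?q0.
by rewrite h; field; rewrite ?a0 ?z0 ?q0.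
Qed.

Lemma ramanujan_psi a b z :
  a != 0 -> (forall j : nat, a != q ^+ j.+1) ->
  (forall j : nat, b * q ^+ j != 1) -> nm (b / a) < nm z < 1 ->
  psi a b z = qpochoo q q * qpochoo q (b / a) *
    (qpochoo q (a * z) * qpochoo q (q / (a * z))) /
    (qpochoo q b * qpochoo q (q / a) *
     (qpochoo q z * qpochoo q (b / (a * z)))).
Proof.
move=> a0 ha hb hz; case/andP: (hz) => baz z1.
have z0 : z != 0 by rewrite -nm_gt0; apply: le_lt_trans baz; exact: nm_ge0.
have h1 := psi_to_0 a0 ha hb hz; have h2 := psi_b0 a0 z0 z1 ha.
have n1 : qpochoo q b != 0 by apply: qpochoo_neq0.
have n2 : qpochoo q z != 0 by apply: qpochoo_small_neq0.
have n3 : qpochoo q (b / (a * z)) != 0.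
  apply: qpochoo_small_neq0 => //; rewrite invfM mulrA nmM nmV.
  by rewrite ltr_pdivrMr ?nm_gt0 // mul1r.
have n4 : qpochoo q (q / a) != 0.
  apply: qpochoo_neq0 => // j; apply: contra (ha j) => /eqP h; apply/eqP.
  by rewrite -[LHS]mulr1 -h exprS; field.
apply: (canRL (mulfK _)); first by rewrite !mulf_neq0.
transitivity ((psi a b z * qpochoo q b * qpochoo q (b / (a * z))) *
  (qpochoo q (q / a) * qpochoo q z)); first by ring.
rewrite h1; transitivity (qpochoo q (b / a) *
  (psi a 0 z * qpochoo q (q / a) * qpochoo q z)); first by ring.
by rewrite h2; ring.
Qed.

End RamanujanSum.

(** * The product over roots of unity and its Laurent coefficients *)

Section ProductFormula.
Variable R : realType.
Local Notation C := (complex R).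
Local Open Scope ring_scope.

(** [X] and [Y] stand for the factors free of [z] in the 1psi1 quotient at base [q^r]; inserting
    [X / Y] and [Y / X] isolates the constant [prod_cst]. *)
Lemma prod_frac (F : fieldType) n (P D X Y : F) (f1 f2 f3 f4 : 'I_n -> F) :
  X != 0 -> Y != 0 ->
  \prod_i (P * (f1 i * f2 i) / (D * (f3 i * f4 i))) =
  (P / D) ^+ n * (X / Y) *
  (Y * (\prod_i f1 i * \prod_i f2 i) / (X * (\prod_i f3 i * \prod_i f4 i))).
Proof.
move=> X0 Y0; rewrite big_split prodfV !big_split /= !prodr_const card_ord.
rewrite expr_div_n !invfM; set D' := _^-1; set f3' := _^-1; set f4' := _^-1.
by field; rewrite X0 Y0.
Qed.

(** The reciprocal of the prefactor in the theorem. *)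
Definition prod_cst (r : nat) (q a b : C) : C :=
  (qpochoo q q * qpochoo q (b / a) / (qpochoo q b * qpochoo q (q / a))) ^+ r *
  (qpochoo (q ^+ r) (b ^+ r) * qpochoo (q ^+ r) (q ^+ r / a ^+ r) /
   (qpochoo (q ^+ r) (q ^+ r) * qpochoo (q ^+ r) (b ^+ r / a ^+ r))).

Lemma prod_psi (r : nat) (q a b z : C) :
  q != 0 -> nm q < 1 -> (0 < r)%N -> a != 0 ->
  (forall j : nat, a ^+ r != (q ^+ r) ^+ j.+1) ->
  (forall j : nat, b ^+ r * (q ^+ r) ^+ j != 1) ->
  nm (b / a) < nm z < 1 ->
  \prod_(i < r) psi q a b (z * zeta R r ^+ i) =
  prod_cst r q a b * psi (q ^+ r) (a ^+ r) (b ^+ r) (z ^+ r).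
Proof.
move=> q0 q1 r0 a0 har hbr hz; case/andP: (hz) => baz z1.
set w := zeta R r; have pw : r.-primitive_root w := zeta_prim R r0.
(* The factors with [z] in the denominator run over the powers of the inverse root. *)
have pv := prim_root_inv pw.
have ha j : a != q ^+ j.+1.
  by apply: contra (har j) => /eqP ->; rewrite exprAC.
have hb j : b * q ^+ j != 1.
  by apply: contra (hbr j) => /eqP h; rewrite exprAC -exprMn h expr1n.
have z0 : z != 0 by rewrite -nm_gt0; apply: le_lt_trans baz; exact: nm_ge0.
have nw i : nm (z * w ^+ i) = nm z by rewrite nmM nmX nm_zeta expr1n mulr1.
have qr0 : q ^+ r != 0 by rewrite expf_neq0.
have qr1 : nm (q ^+ r) < 1 by rewrite nmX exprn_ilt1 ?nm_ge0 // -lt0n.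
have ar0 : a ^+ r != 0 by rewrite expf_neq0.
have bar : nm (b / a) ^+ r < nm z ^+ r.
  by rewrite ltrXn2r ?nm_ge0 // -lt0n.
have hzr : nm (b ^+ r / a ^+ r) < nm (z ^+ r) < 1.
  by rewrite -expr_div_n !nmX bar exprn_ilt1 ?nm_ge0 // -lt0n.
have ba1 : nm (b / a) < 1 by apply: lt_trans z1.
have n1 : qpochoo (q ^+ r) (b ^+ r) != 0 by apply: qpochoo_neq0.
have n4 : qpochoo (q ^+ r) (q ^+ r / a ^+ r) != 0.
  apply: qpochoo_neq0 => // j; apply: contra (har j) => /eqP h; apply/eqP.
  by rewrite -[LHS]mulr1 -h [in RHS]exprS; field.
have n5 : qpochoo (q ^+ r) (q ^+ r) != 0 by apply: qpochoo_small_neq0.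
have n6 : qpochoo (q ^+ r) (b ^+ r / a ^+ r) != 0.
  apply: qpochoo_small_neq0 => //.
  by rewrite -expr_div_n nmX exprn_ilt1 ?nm_ge0 // -lt0n.
rewrite (ramanujan_psi qr0 qr1 ar0 har hbr hzr).
under eq_bigr => i _ do rewrite (ramanujan_psi q0 q1 a0 ha hb) ?nw //.
rewrite (prod_frac _ _ _ _ _ _ (mulf_neq0 n1 n4) (mulf_neq0 n5 n6)).
have -> : \prod_(i < r) qpochoo q (a * (z * w ^+ i)) =
    qpochoo (q ^+ r) (a ^+ r * z ^+ r).
  rewrite -exprMn -(prod_qpochoo _ q1 pw).
  by apply: eq_bigr => i _; rewrite mulrA.
have -> : \prod_(i < r) qpochoo q (q / (a * (z * w ^+ i))) =
    qpochoo (q ^+ r) (q ^+ r / (a ^+ r * z ^+ r)).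
  rewrite -exprMn -expr_div_n -(prod_qpochoo _ q1 pv).
  by apply: eq_bigr => i _; rewrite exprVn !invfM !mulrA.
have -> : \prod_(i < r) qpochoo q (b / (a * (z * w ^+ i))) =
    qpochoo (q ^+ r) (b ^+ r / (a ^+ r * z ^+ r)).
  rewrite -exprMn -expr_div_n -(prod_qpochoo _ q1 pv).
  by apply: eq_bigr => i _; rewrite exprVn !invfM !mulrA.
rewrite (prod_qpochoo _ q1 pw); reflexivity.
Qed.

Section Convolution.
Variables (n : nat) (q a b : C) (t : R).
Local Notation r := n.+1.
Local Notation I := {ffun 'I_n -> int}.
Local Notation w := (zeta R r).
Hypotheses (q0 : q != 0) (q1 : nm q < 1) (a0 : a != 0).
Hypothesis har : forall j : nat, a ^+ r != (q ^+ r) ^+ j.+1.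
Hypothesis hbr : forall j : nat, b ^+ r * (q ^+ r) ^+ j != 1.
Hypothesis ht : nm (b / a) < t < 1.

Definition cf (k : int) : C := qpoch q a k / qpoch q b k.

(** The factor of the product at the root [w^0 = 1] is the separate last coordinate; it becomes the
    inner series of the theorem, and the other [r - 1] coordinates carry the roots. *)
Definition conv_term (p : I * int) : C :=
  (\prod_i (cf (p.1 i) * (w ^+ i.+1) ^ (p.1 i))) * cf p.2.

Definition tot (k : I) : int := \sum_i k i.

Lemma radius_gt0 : 0 < t.
Proof. by case/andP: ht => h _; apply: le_lt_trans h; exact: nm_ge0. Qed.

Lemma prod_exprz (J : finType) (z : C) (k : J -> int) : z != 0 ->
  \prod_i z ^ (k i) = z ^ (\sum_i k i).
Proof.
move=> z0; apply: esym; elim/big_ind2 : _ => //.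
by move=> x1 x2 y1 y2 <- <-; rewrite expfzDr.
Qed.

Lemma conv_sum (z : C) : nm z = t ->
  asum (fun p => conv_term p * z ^ (tot p.1 + p.2)) /\
  has_sum (fun p => conv_term p * z ^ (tot p.1 + p.2))
    (prod_cst r q a b * psi (q ^+ r) (a ^+ r) (b ^+ r) (z ^+ r)).
Proof.
move=> zt; have z0 : z != 0 by rewrite -nm_gt0 zt radius_gt0.
have ha j : a != q ^+ j.+1.
  by apply: contra (har j) => /eqP ->; rewrite exprAC.
have hb j : b * q ^+ j != 1.
  by apply: contra (hbr j) => /eqP h; rewrite exprAC -exprMn h expr1n.
have hz i : nm (b / a) < nm (z * w ^+ i) < 1.
  by rewrite [nm (z * _)]nmM nmX nm_zeta expr1n mulr1 zt.
have hz0 : nm (b / a) < nm z < 1 by rewrite zt.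
have h1 (i : nat) := asum_psi q0 q1 a0 ha hb (hz i).
have h2 (i : nat) := has_sum_psi q0 q1 a0 ha hb (hz i).
have [f1 f2] := has_sum_ffun (fun i : 'I_n => h1 i.+1) (fun i : 'I_n => h2 i.+1).
have g1 := asum_psi q0 q1 a0 ha hb hz0.
have g2 := has_sum_psi q0 q1 a0 ha hb hz0.
have E (p : I * int) :
    \prod_(i < n) psi_term q a b (z * w ^+ i.+1) (p.1 i) *
    psi_term q a b z p.2 = conv_term p * z ^ (tot p.1 + p.2).
  rewrite (eq_bigr (fun i : 'I_n =>
    cf (p.1 i) * (w ^+ i.+1) ^ (p.1 i) * z ^ (p.1 i))); last first.
    by move=> i _; rewrite /psi_term expfzMl [z ^ _ * _]mulrC mulrA.
  by rewrite big_split /= prod_exprz // mulrACA -expfzDr.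
have := asum_mul f1 g1; have := has_sum_mul f1 g1 f2 g2.
rewrite -(prod_psi q0 q1 (ltn0Sn n) a0 har hbr hz0).
have -> : \prod_(i < r) psi q a b (z * w ^+ i) =
    (\prod_(i < n) psi q a b (z * w ^+ i.+1)) * psi q a b z.
  by rewrite big_ord_recl expr0 mulr1; exact: mulrC.
have -> : (fun p : I * int => conv_term p * z ^ (tot p.1 + p.2)) =
  (fun p : I * int => \prod_(i < n) psi_term q a b (z * w ^+ i.+1) (p.1 i) *
    psi_term q a b z p.2) by apply/funext => p; rewrite E.
by [].
Qed.

Definition conv_coef (N : int) : C := usum (fun k : I => conv_term (k, N - tot k)).

Section Weighted.
Variables (Q : int -> C) (M : R).
Hypotheses (M0 : 0 <= M) (hQ : forall N, nm (Q N) <= M * t ^ N).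

(** Comparison with the point [z = t]. The weight is left abstract because two are used: [z^N] to
    identify the coefficients, then the Gaussian weight of the theorem. *)
Lemma asum_weighted : asum (fun p => conv_term p * Q (tot p.1 + p.2)).
Proof.
have tz : nm t%:C%C = t by rewrite nm_real gtr0_norm // radius_gt0.
have [h _] := conv_sum tz.
apply: asum_le M0 _ h => p.
by rewrite nmM [nm (_ * _ ^ _)]nmM nmXz tz mulrCA ler_wpM2l ?nm_ge0.
Qed.

Lemma has_sum_weighted :
  has_sum (fun N => Q N * conv_coef N)
    (usum (fun p => conv_term p * Q (tot p.1 + p.2))).
Proof.
have hs := asum_usum asum_weighted; set S := usum _ in hs *.
(* A shear replacing the last coordinate by the total, so that the fibres are the convolution
   sums. *)
pose h (p : int * I) : I * int := (p.2, p.1 - tot p.2).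
have hI : injective h.
  by move=> [N k] [N' k'] [] /= -> /addIr ->.
have hs' : has_sum ((fun p => conv_term p * Q (tot p.1 + p.2)) \o h) S.
  apply/(has_sum_inj _ hI) => //.
  by move=> [k m] /(_ (m + tot k, k)) []; rewrite /h /= addrK.
apply: has_sum_fiber hs' _ => N.
have tz : nm t%:C%C = t by rewrite nm_real gtr0_norm // radius_gt0.
have [as1 _] := conv_sum tz.
have iI : injective (fun k : I => (k, N - tot k)) by move=> k k' [].
(* The weight [Q N] may vanish, so the fibre is taken from the family at [z = t], where the weight
   is the nonzero constant [t^N]. *)
have as2 : asum (fun k : I => conv_term (k, N - tot k)).
  have t0 := radius_gt0; have t0N := exprz_gt0 N t0.
  apply: asum_le (_ : 0 <= (t ^ N)^-1) _ (asum_inj iI as1) => [|k].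
    by rewrite invr_ge0 ltW.
  rewrite /= [nm (_ * _ ^ _)]nmM nmXz tz [tot k + _]addrC subrK.
  rewrite mulrCA mulVf ?mulr1 //.
  by rewrite gt_eqF.
apply: eq_has_sum (has_sumZ (Q N) (asum_usum as2)) => k.
by rewrite /= [tot k + _]addrC subrK mulrC.
Qed.

End Weighted.

(** The coefficient of [z^N] in the base [q^r] series at [z^r]. *)
Definition cfr (N : int) : C :=
  if (r %| N)%Z then
    qpoch (q ^+ r) (a ^+ r) (N %/ r)%Z / qpoch (q ^+ r) (b ^+ r) (N %/ r)%Z
  else 0.

Lemma mulr_int_inj : injective (fun m : int => r%:Z * m).
Proof. by apply: mulfI. Qed.

Lemma cfr_mul (m : int) :
  cfr (r%:Z * m) = qpoch (q ^+ r) (a ^+ r) m / qpoch (q ^+ r) (b ^+ r) m.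
Proof. by rewrite /cfr dvdz_mulr ?dvdzz // mulKz. Qed.

Lemma cfr_off (N : int) : (forall m : int, r%:Z * m <> N) -> cfr N = 0.
Proof.
rewrite /cfr; case: ifP => // rN /(_ (N %/ r)%Z) []; rewrite mulrC.
exact: divzK.
Qed.

Lemma convE (N : int) : conv_coef N = prod_cst r q a b * cfr N.
Proof.
have t0 := radius_gt0.
have tz : nm t%:C%C = t by rewrite nm_real gtr0_norm.
have tC : t%:C%C != 0 :> C by rewrite -nm_gt0 tz.
(* The factor [t^N] moves the comparison from the circle of radius [t] to the unit circle. *)
suff : (conv_coef N - prod_cst r q a b * cfr N) * t%:C%C ^ N = 0.
  move/eqP; rewrite mulf_eq0 expfz_eq0 (negPf tC) andbF orbF subr_eq0.
  by move/eqP.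
apply: (laurent_unique (u := fun N =>
  (conv_coef N - prod_cst r q a b * cfr N) * t%:C%C ^ N)) => v v1.
pose z := t%:C%C * v : C; have zt : nm z = t by rewrite nmM tz v1 mulr1.
have [_ s1] := conv_sum zt.
have s2 := has_sum_weighted (Q := fun N => z ^ N) ler01.
have s3 : has_sum (fun N => z ^ N * conv_coef N)
    (prod_cst r q a b * psi (q ^+ r) (a ^+ r) (b ^+ r) (z ^+ r)).
  rewrite -(has_sum_usum s1); apply: s2 => M.
  by rewrite mul1r nmXz zt.
have hzr : nm (b ^+ r / a ^+ r) < nm (z ^+ r) < 1.
  case/andP: ht => bt t1.
  by rewrite -expr_div_n !nmX zt ltrXn2r ?nm_ge0 // exprn_ilt1 // ltW.
have qr0 : q ^+ r != 0 by rewrite expf_neq0.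
have qr1 : nm (q ^+ r) < 1 by rewrite nmX exprn_ilt1 ?nm_ge0.
have ar0 : a ^+ r != 0 by rewrite expf_neq0.
have s4 : has_sum (fun N => cfr N * z ^ N)
    (psi (q ^+ r) (a ^+ r) (b ^+ r) (z ^+ r)).
  apply/(has_sum_inj _ mulr_int_inj).
    by move=> M /cfr_off ->; rewrite mul0r.
  apply: eq_has_sum (has_sum_psi qr0 qr1 ar0 har hbr hzr) => m.
  by rewrite /= cfr_mul /psi_term -exprz_exp.
have := has_sumB s3 (has_sumZ (prod_cst r q a b) s4); rewrite subrr.
apply: eq_has_sum => M; rewrite /z expfzMl; ring.
Qed.

End Convolution.
End ProductFormula.

(** * Growth of the weight [q^(alpha N^2) x^N] *)

Section GaussianWeight.
Variable R : realType.
Local Notation C := (complex R).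
Local Open Scope ring_scope.

Lemma qpowD (lq : C) (y y' : R) : qpow lq (y + y') = qpow lq y * qpow lq y'.
Proof. by rewrite /qpow -cexpD rmorphD mulrDl. Qed.

Lemma qpow_neq0 (lq : C) (y : R) : qpow lq y != 0.
Proof. by rewrite -nm_gt0 nm_cexp expR_gt0. Qed.

Lemma qpow_int (lq : C) (y : R) (m : int) :
  qpow lq (y * m%:~R) = qpow lq y ^ m.
Proof.
have N k : qpow lq (y * k%:R) = qpow lq y ^+ k.
  rewrite /qpow -cexp_natmul; congr cexp.
  by rewrite mulrA -[X in _ = X * _ * _](rmorph_nat (real_complex R)) -rmorphM [_ * y]mulrC.
case: m => k; first exact: N.
rewrite NegzE -exprnN -N; apply: (mulfI (qpow_neq0 lq (y * k.+1%:R))).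
rewrite divff ?qpow_neq0 // -qpowD mulrNz mulrN subrr.
by rewrite /qpow rmorph0 mul0r cexp0.
Qed.

Lemma nm_qpow (lq : C) (y : R) : nm (qpow lq y) = expR (y * complex.Re lq).
Proof. by rewrite nm_cexp; case: lq => u v; simpc. Qed.

Lemma expR_int (y : R) (m : int) : expR (m%:~R * y) = expR y ^ m.
Proof.
case: m => k; first by rewrite expRM_natl.
by rewrite NegzE mulrNz mulNr expRN -exprnN expRM_natl.
Qed.

(** For [alpha = 0], [t = X] works. Otherwise any [t] in the interval does: with
    [c = - alpha Re(lq) > 0] and [L = ln (X / t)], completing the square gives
    [- c N^2 + N L <= L^2 / (4 c)]. *)
Lemma gauss_weight (lq : C) (alpha rho X : R) :
  complex.Re lq < 0 -> 0 <= alpha -> 0 < X -> 0 <= rho < 1 ->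
  (alpha = 0 -> rho < X < 1) ->
  exists t M, [/\ rho < t < 1, 0 <= M & forall N : int,
    expR (alpha * N%:~R ^+ 2 * complex.Re lq) * X ^ N <= M * t ^ N].
Proof.
move=> l0 al0 X0 /andP[r0 r1] hX.
have [a0|a0] := eqVneq alpha 0.
  exists X, 1; split => //; first exact: hX.
  by move=> N; rewrite a0 !mul0r expR0.
have {a0 al0} al0 : 0 < alpha by rewrite lt_def a0.
pose t := (rho + 1) / 2; have t0 : 0 < t by rewrite /t; lra.
pose c := - (alpha * complex.Re lq).
have c0 : 0 < c by rewrite oppr_gt0 pmulr_rlt0.
pose L := ln (X / t).
exists t, (expR (L ^+ 2 / (4 * c))); split; first by rewrite /t; lra.
  exact: expR_ge0.
move=> N; have Xt : X = expR L * t.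
  have Xt0 : X / t \in Num.pos by rewrite posrE divr_gt0.
  by rewrite /L (lnK Xt0) mulfVK // gt_eqF.
rewrite {1}Xt expfzMl -expR_int mulrA -expRD ler_pM2r ?exprz_gt0 //.
rewrite ler_expR ler_pdivlMr ?mulr_gt0 //.
rewrite -subr_ge0; set m : R := N%:~R.
suff -> : L ^+ 2 - (alpha * m ^+ 2 * complex.Re lq + m * L) * (4 * c) =
  (2 * c * m - L) ^+ 2 by exact: sqr_ge0.
by rewrite /c; ring.
Qed.

End GaussianWeight.

(** * Assembly of the identity *)

Lemma prefactor_inv (F : fieldType) (r : nat) (X Y Z W : F) :
  X != 0 -> Y != 0 -> Z != 0 -> W != 0 ->
  X ^+ r / Y ^+ r * (Z / W) * ((Y / X) ^+ r * (W / Z)) = 1.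
Proof.
by move=> X0 Y0 Z0 W0; rewrite expr_div_n; field; rewrite !expf_neq0 // Z0 W0.
Qed.

Lemma qpochsoo2 (F : numFieldType) (p u v : F) :
  qpochsoo p [:: u; v] = qpochoo p u * qpochoo p v.
Proof. by rewrite /qpochsoo !big_cons big_nil mulr1. Qed.

Lemma mulKl_eq (F : fieldType) (p c B : F) : p * c = 1 -> B = p * (c * B).
Proof. by move=> pc; rewrite mulrA pc mul1r. Qed.

Theorem theorem2p4 (R : realType) (q lq : complex R) (alpha : R) (r : nat)
    (a b x : complex R)
    (hq : 0 < `|q| < 1) (hlq : cexp lq = q)
    (halpha : 0 <= alpha) (hr : (2 <= r)%N)
    (ha : a != 0) (hx : x != 0) (hba : `|b / a| < 1)
    (har : forall j : nat, (1 <= j)%N -> a ^+ r != q ^+ (r * j))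
    (hbr : forall j : nat, b ^+ r != q ^- (r * j))
    (h0 : alpha = 0 -> `|b / a| < `|x| < 1) :
  [/\ usummable
        (Bterm (q ^+ r) (r%:R * lq) (r%:R * alpha) (a ^+ r) (b ^+ r) (x ^+ r)),
      forall m : int,
        usummable (Bterm q lq alpha a b (x * qpow lq (2 * alpha * m%:~R))),
      usummable (@multiterm R r q lq alpha a b x) &
      Bseries (q ^+ r) (r%:R * lq) (r%:R * alpha) (a ^+ r) (b ^+ r) (x ^+ r) =
        qpochsoo q [:: b; q / a] ^+ r / qpochsoo q [:: q; b / a] ^+ r
        * (qpochsoo (q ^+ r) [:: q ^+ r; b ^+ r * a ^- r]
           / qpochsoo (q ^+ r) [:: b ^+ r; q ^+ r * a ^- r])
        * usum (@multiterm R r q lq alpha a b x)].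
Proof.
have q0 : q != 0 by rewrite -normr_gt0; case/andP: hq.
have q1 : nm q < 1 by case/andP: hq => _; rewrite normE ltcR.
have ba1 : nm (b / a) < 1 by move: hba; rewrite normE ltcR.
have x0 : 0 < nm x by rewrite nm_gt0.
have l0 : complex.Re lq < 0.
  by rewrite -expR_lt1 -nm_cexp hlq.
have hX : alpha = 0 -> nm (b / a) < nm x < 1.
  by move=> /h0; rewrite !normE !ltcR.
have rho01 : 0 <= nm (b / a) < 1 by rewrite nm_ge0.
have [t [M [ht M0 hQ0]]] := gauss_weight l0 halpha x0 rho01 hX.
case: r hr har hbr => [//|n] hr har hbr; set r := n.+1 in hr har hbr *.
have har' j : a ^+ r != (q ^+ r) ^+ j.+1 by rewrite -exprM; exact: har.
have hbr' j : b ^+ r * (q ^+ r) ^+ j != 1.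
  apply: contra (hbr j) => /eqP h; apply/eqP.
  by rewrite exprM -[RHS]mul1r -h mulfK // !expf_neq0.
pose Q (N : int) : complex R := qpow lq (alpha * N%:~R ^+ 2) * x ^ N.
have hQ N : nm (Q N) <= M * t ^ N by rewrite nmM nm_qpow nmXz.
have w0 := zeta_neq0 R r.
have as1 := asum_weighted q0 q1 ha har' hbr' ht M0 hQ.
have hs := asum_usum as1; set S := usum _ in hs.
have t0 := radius_gt0 ht.
(* q^(alpha s^2) q^(2 alpha s m) q^(alpha m^2) = q^(alpha (s + m)^2) *)
have QD (s m : int) : Q (s + m) = qpow lq (alpha * s%:~R ^+ 2) * x ^ s *
    (qpow lq (alpha * m%:~R ^+ 2) * (x * qpow lq (2 * alpha * s%:~R)) ^ m).
  rewrite /Q expfzMl -qpow_int expfzDr //.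
  have -> : alpha * (s + m)%:~R ^+ 2 = alpha * s%:~R ^+ 2 +
      alpha * m%:~R ^+ 2 + 2 * alpha * s%:~R * m%:~R by rewrite intrD; ring.
  by rewrite !qpowD; ring.
have ha' j : a != q ^+ j.+1.
  by apply: contra (har' j) => /eqP ->; rewrite exprAC.
have hb' j : b * q ^+ j != 1.
  by apply: contra (hbr' j) => /eqP h; rewrite exprAC -exprMn h expr1n.
pose tc : complex R := t%:C%C.
have tz : nm tc = t by rewrite nm_real gtr0_norm.
have ht' : nm (b / a) < nm tc < 1 by rewrite tz.
have asB (s : int) :
    asum (Bterm q lq alpha a b (x * qpow lq (2 * alpha * s%:~R))).
  (* The argument [x q^(2 alpha s)] may leave the annulus. Multiplied by the nonzero [P], the [m]-th
     term becomes [cf m * Q (s + m)], and the bound on [Q] compares it with the series at [t]. *)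
  pose P : complex R := qpow lq (alpha * s%:~R ^+ 2) * x ^ s.
  have P0 : 0 < nm P by rewrite nm_gt0 mulf_neq0 ?qpow_neq0 // expfz_neq0.
  apply: asum_le (_ : 0 <= M * t ^ s / nm P) _
    (asum_psi q0 q1 ha ha' hb' ht') => [|m].
    by rewrite divr_ge0 ?mulr_ge0 ?exprz_ge0 // ltW.
  have : nm (cf q a b m * Q (s + m)) <= nm (cf q a b m) * (M * t ^ (s + m)).
    by rewrite nmM ler_wpM2l ?nm_ge0.
  have -> : cf q a b m * Q (s + m) =
      P * Bterm q lq alpha a b (x * qpow lq (2 * alpha * s%:~R)) m.
    by rewrite QD /Bterm /cf -/P; ring.
  rewrite nmM -ler_pdivlMl // => h; apply: le_trans h _.
  have -> : psi_term q a b tc m = cf q a b m * tc ^ m by [].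
  rewrite nmM nmXz tz expfzDr ?gt_eqF //.
  by rewrite le_eqVlt; apply/orP; left; apply/eqP; ring.
(* First grouping of the double family: the fibre over [k] sums to the summand of the theorem. *)
have multi (k : {ffun 'I_n -> int}) : has_sum
    (fun m => conv_term q a b (k, m) * Q (tot k + m))
    (multiterm (r := r) q lq alpha a b x k).
  have := has_sumZ ((\prod_i qpoch q a (k i)) *
    zeta R r ^ (\sum_(i < n) i.+1%:Z * k i) *
    qpow lq (alpha * (tot k)%:~R ^+ 2) * x ^ tot k / (\prod_i qpoch q b (k i)))
    (asum_usum (asB (tot k))).
  apply: eq_has_sum => m; rewrite QD /conv_term /Bterm /=.
  rewrite big_split /= [\prod_i cf _ _ _ _]big_split /= prodfV.
  have -> : \prod_(i < n) (zeta R r ^+ i.+1) ^ k i =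
      zeta R r ^ (\sum_(i < n) i.+1%:Z * k i).
    by rewrite -prod_exprz //; apply: eq_bigr => i _; rewrite exprnP exprz_exp.
  rewrite /cf; ring.
have hmulti : has_sum (multiterm (r := r) q lq alpha a b x) S.
  exact: has_sum_fiber hs multi.
have qr0 : q ^+ r != 0 by rewrite expf_neq0.
have qr1 : nm (q ^+ r) < 1 by rewrite nmX exprn_ilt1 ?nm_ge0.
have ar0 : a ^+ r != 0 by rewrite expf_neq0.
have bar1 : nm (b ^+ r / a ^+ r) < 1.
  by rewrite -expr_div_n nmX exprn_ilt1 ?nm_ge0.
(* At [N = r m] the exponents agree, since [alpha (r m)^2 lq = (r alpha) m^2 (r lq)]. *)
have BE (m : int) : Bterm (q ^+ r) (r%:R * lq) (r%:R * alpha) (a ^+ r) (b ^+ r)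
    (x ^+ r) m = cfr n q a b (r%:Z * m) * Q (r%:Z * m).
  rewrite cfr_mul /Bterm /Q -exprz_exp -mulrA; congr (_ * (_ * _)).
  rewrite /qpow; congr cexp.
  have rC : (r%:R : complex R) = (r%:R : R)%:C%C.
    by rewrite -(rmorph_nat (real_complex R)).
  have -> : alpha * (r%:Z * m)%:~R ^+ 2 =
      r%:R * alpha * m%:~R ^+ 2 * r%:R by rewrite intrM; ring.
  by rewrite rC mulrA -(rmorphM (real_complex R)).
have asBr : asum (Bterm (q ^+ r) (r%:R * lq) (r%:R * alpha) (a ^+ r) (b ^+ r)
    (x ^+ r)).
  have htr : nm (b ^+ r / a ^+ r) < nm (tc ^+ r) < 1.
    case/andP: ht' => bt t1.
    by rewrite -expr_div_n !nmX ltrXn2r ?nm_ge0 // exprn_ilt1 ?nm_ge0.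
  apply: asum_le M0 _ (asum_psi qr0 qr1 ar0 har' hbr' htr) => m.
  rewrite BE cfr_mul nmM [nm (psi_term _ _ _ _ _)]nmM nmXz nmX tz mulrCA.
  by rewrite ler_wpM2l ?nm_ge0 // exprnP exprz_exp.
(* Second grouping, by the total: only multiples of [r] contribute. *)
have SE : S = prod_cst r q a b *
    Bseries (q ^+ r) (r%:R * lq) (r%:R * alpha) (a ^+ r) (b ^+ r) (x ^+ r).
  apply: has_sum_unique (has_sumZ (prod_cst r q a b) (asum_usum asBr)).
  have := has_sum_weighted q0 q1 ha har' hbr' ht M0 hQ; rewrite -/S.
  have off N : (forall m : int, r%:Z * m <> N) -> Q N * conv_coef n q a b N = 0.
    by move=> /cfr_off h; rewrite (convE q0 q1 ha har' hbr' ht) h !mulr0.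
  move/(has_sum_inj _ (@mulr_int_inj n) off).2; apply: eq_has_sum => m.
  by rewrite /= (convE q0 q1 ha har' hbr' ht) BE; ring.
split.
- exact: asum_usummable asBr.
- by move=> m; exact: asum_usummable (asB m).
- exact: has_sum_usummable hmulti.
have n1 : qpochoo q b != 0 by apply: qpochoo_neq0.
have n2 : qpochoo q (q / a) != 0.
  apply: qpochoo_neq0 => // j; apply: contra (ha' j) => /eqP h; apply/eqP.
  by rewrite -[LHS]mulr1 -h exprS; field.
have n3 : qpochoo (q ^+ r) (b ^+ r) != 0 by apply: qpochoo_neq0.
have n4 : qpochoo (q ^+ r) (q ^+ r / a ^+ r) != 0.
  apply: qpochoo_neq0 => // j; apply: contra (har' j) => /eqP h; apply/eqP.
  by rewrite -[LHS]mulr1 -h [in RHS]exprS; field.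
have n5 : qpochoo q q != 0 by apply: qpochoo_small_neq0.
have n6 : qpochoo q (b / a) != 0 by apply: qpochoo_small_neq0.
have n7 : qpochoo (q ^+ r) (q ^+ r) != 0 by apply: qpochoo_small_neq0.
have n8 : qpochoo (q ^+ r) (b ^+ r / a ^+ r) != 0.
  by apply: qpochoo_small_neq0.
have K := prefactor_inv r (mulf_neq0 n1 n2) (mulf_neq0 n5 n6)
  (mulf_neq0 n7 n8) (mulf_neq0 n3 n4).
have U := has_sum_usum hmulti; rewrite SE in U.
rewrite !qpochsoo2 U.
exact: mulKl_eq K.
Qed.
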